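(* Let $\Gamma$ be a group generated by a finite set $X$, and suppose that $\Gamma$ is recursively presentable. Then the following are equivalent: (i) $\Gamma$ is amenable; (ii) $\Gamma$ has subrecursive Følner function; (iii) there exists an algorithm which on input $n\in\mathbb N$ outputs a finite set $F\subset\mathbb F_{\mathsf X}$ such that $\pi_\Gamma(F)$ contains an $n$-Følner set; (iv) $\Gamma$ has computable Reiter functions.
   Context: $\mathbb N$ denotes the positive integers; $\mathbb R^+$, $\mathbb Q^+$ denote the non-negative reals and rationals. $\mathsf X$ is a set with a bijection $\mathsf X\to X$, $\mathbb F_{\mathsf X}$ is the free group on $\mathsf X$, and $\pi_\Gamma\colon\mathbb F_{\mathsf X}\to\Gamma$ is the induced epimorphism. $\Gamma$ is recursively presentable if there is a recursive $R\subset\mathbb F_{\mathsf X}$ whose normal closure is $\ker\pi_\Gamma$. A non-empty finite $\Omega\subset\Gamma$ is an $n$-Følner set (with respect to $X$) if $|\Omega\setminus x\Omega|/|\Omega|\le n^{-1}$ for all $x\in X$. $\Gamma$ is amenable if $n$-Følner sets exist for all $n\in\mathbb N$. The Følner function is $F_{\Gamma,X}(n):=\min\{|\Omega|:\Omega\text{ an }n\text{-Følner set}\}$ ($\min\emptyset=\infty$); it is subrecursive if there is a recursive (computable, total) function $u\colon\mathbb N\to\mathbb N$ with $F_{\Gamma,X}(n)\le u(n)$ for all $n$. A summable non-zero function $h\colon\Gamma\to\mathbb R^+$ is $n$-invariant (with respect to $X$) if $\sum_{g\in\Gamma}|h(g)-h(x^{-1}g)|\le n^{-1}\sum_{g\in\Gamma}h(g)$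 for all $x\in X$. $\Gamma$ has computable Reiter functions if there is an algorithm which on input $n\in\mathbb N$ outputs a finitely supported function $f\colon\mathbb F_{\mathsf X}\to\mathbb Q^+$ whose pushforward ${\pi_\Gamma}_*(f)(g):=\sum_{\nu\in\pi_\Gamma^{-1}(g)}f(\nu)$ is (non-zero and) $n$-invariant. *)

(* Defs.v *)
From HB Require Import structures.
From mathcomp Require Import all_boot all_order all_algebra.
From mathcomp Require Import finmap.
From mathcomp Require Import boolp classical_sets fsbigop reals ereal esum.

Set Implicit Arguments.
Unset Strict Implicit.
Unset Printing Implicit Defensive.

Import Order.TTheory GRing.Theory Num.Theory.

Local Open Scope classical_set_scope.
Local Open Scope ring_scope.
Local Open Scope group_scope.

(* Total (general) recursive functions of k variables: Kleene's schemes, with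
   minimization restricted to regular functions, so that no partial function
   arises. *)
Inductive recursive : forall k, (k.-tuple nat -> nat) -> Prop :=
| recursive_zero : recursive (fun _ : 0.-tuple nat => 0%N)
| recursive_succ : recursive (fun v : 1.-tuple nat => (thead v).+1)
| recursive_proj k (i : 'I_k) : recursive (fun v : k.-tuple nat => tnth v i)
| recursive_comp k m (g : m.-tuple nat -> nat)
    (h : 'I_m -> k.-tuple nat -> nat) :
    recursive g -> (forall i, recursive (h i)) ->
    recursive (fun v : k.-tuple nat => g [tuple h i v | i < m])
| recursive_primrec k (g : k.-tuple nat -> nat) (h : k.+2.-tuple nat -> nat) :
    recursive g -> recursive h ->
    recursive (fun v : k.+1.-tuple nat =>
      nat_rect (fun _ => nat) (g [tuple of behead v])
        (fun i r => h [tuple of i :: r :: behead v]) (thead v))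
| recursive_mu k (g : k.+1.-tuple nat -> nat) (f : k.-tuple nat -> nat) :
    recursive g ->
    (forall v : k.-tuple nat,
        g [tuple of f v :: v] = 0%N /\
        forall i, (i < f v)%N -> g [tuple of i :: v] <> 0%N) ->
    recursive f.

Definition recursive1 (u : nat -> nat) : Prop :=
  recursive (fun v : 1.-tuple nat => u (thead v)).

Section Subgroups.
Variable G : groupType.

Definition subgroup (H : set G) : Prop :=
  [/\ H 1, forall x y, H x -> H y -> H (x * y) & forall x, H x -> H x^-1].

Definition normal_subgroup (H : set G) : Prop :=
  subgroup H /\ forall x y, H x -> H (x ^ y).

Definition generated (A : set G) : set G := smallest subgroup A.

Definition normal_closure (A : set G) : set G := smallest normal_subgroup A.

End Subgroups.

Section FreeGroup.
Variable S : choiceType.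

(* (false, a) is the letter a, and (true, a) is its formal inverse. *)
Definition letter : choiceType := (bool * S)%type.

Definition letter_inv (l : letter) : letter := (~~ l.1, l.2).

Definition reduced (w : seq letter) : bool :=
  sorted (fun l m => m != letter_inv l) w.

(* The reduced form of l :: w, for w reduced. *)
Definition push (l : letter) (w : seq letter) : seq letter :=
  if w is m :: w' then if m == letter_inv l then w' else l :: w else [:: l].

Definition word_mul (u v : seq letter) : seq letter := foldr push v u.

Definition word_inv (u : seq letter) : seq letter :=
  rev [seq letter_inv l | l <- u].

Lemma letter_invK : involutive letter_inv.
Proof. by case=> b a; rewrite /letter_inv /= negbK. Qed.

Lemma reduced_behead l w : reduced (l :: w) -> reduced w.
Proof. by case: w => //= m w /andP[]. Qed.

Lemma reduced_push l w : reduced w -> reduced (push l w).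
Proof.
case: w => [//|m w] rw /=; case: eqP => [_|/eqP ne]; first exact: reduced_behead rw.
by move: rw; rewrite /reduced /= => ->; rewrite ne.
Qed.

Lemma reduced_word_mul u v : reduced v -> reduced (word_mul u v).
Proof. by move=> rv; elim: u => //= l u; exact: reduced_push. Qed.

Lemma pushK l w : reduced w -> push (letter_inv l) (push l w) = w.
Proof.
case: w => [_|m w] /=; first by rewrite letter_invK eqxx.
case: (eqVneq m (letter_inv l)) => [-> rw|_ _] /=; last by rewrite letter_invK eqxx.
by case: w rw => //= k w /andP[/negPf ->].
Qed.

Lemma push_reduced l w : reduced (l :: w) -> push l w = l :: w.
Proof. by case: w => //= m w /andP[/negPf ->]. Qed.

Lemma word_mul_push l u v : reduced u -> reduced v ->
  word_mul (push l u) v = push l (word_mul u v).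
Proof.
case: u => [//|m u] ru rv /=; case: eqP => [->|//].
by have := pushK (letter_inv l) (reduced_word_mul u rv); rewrite letter_invK => ->.
Qed.

Lemma word_mulA u v w : reduced v -> reduced w ->
  word_mul u (word_mul v w) = word_mul (word_mul u v) w.
Proof.
move=> rv rw; elim: u => //= l u ->.
by rewrite word_mul_push // reduced_word_mul.
Qed.

Lemma word_mulw1 u : reduced u -> word_mul u [::] = u.
Proof.
elim: u => //= l u IHu rlu.
by rewrite IHu ?push_reduced //; exact: reduced_behead rlu.
Qed.

Lemma word_mul_cat u v w : word_mul (u ++ v) w = word_mul u (word_mul v w).
Proof. by rewrite /word_mul foldr_cat. Qed.

Lemma word_mulVK u w : reduced w -> word_mul (word_inv u) (word_mul u w) = w.
Proof.
elim: u w => //= l u IHu w rw.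
rewrite /word_inv /= rev_cons -cats1 word_mul_cat /= pushK ?IHu //.
exact: reduced_word_mul.
Qed.

Lemma word_invK : involutive word_inv.
Proof. by move=> u; rewrite /word_inv map_rev revK (mapK letter_invK). Qed.

Lemma reduced_word_inv u : reduced u -> reduced (word_inv u).
Proof.
rewrite /reduced /word_inv rev_sorted sorted_map => ru.
apply: sub_sorted ru => l m /=.
by apply: contraNneq => ->; rewrite !letter_invK.
Qed.

Record freegroup := FreeGroup { word :> seq letter; _ : reduced word }.

HB.instance Definition _ := [isSub for word].
HB.instance Definition _ := [Choice of freegroup by <:].

Lemma freegroupP (w : freegroup) : reduced w. Proof. exact: valP w. Qed.

Definition fg_one : freegroup := @FreeGroup [::] isT.
Definition fg_mul (u v : freegroup) : freegroup :=
  FreeGroup (reduced_word_mul u (freegroupP v)).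
Definition fg_inv (u : freegroup) : freegroup :=
  FreeGroup (reduced_word_inv (freegroupP u)).

Lemma fg_mulA : associative fg_mul.
Proof. by move=> u v w; apply: val_inj; exact: word_mulA (freegroupP _) (freegroupP _). Qed.
Lemma fg_mul1 : left_id fg_one fg_mul.
Proof. by move=> u; exact: val_inj. Qed.
Lemma fg_mulr1 : right_id fg_one fg_mul.
Proof. by move=> u; apply: val_inj; exact: word_mulw1 (freegroupP u). Qed.
Lemma fg_mulV : left_inverse fg_one fg_inv fg_mul.
Proof.
move=> u; apply: val_inj => /=; rewrite -{2}(word_mulw1 (freegroupP u)).
exact: word_mulVK.
Qed.
Lemma fg_mulrV : right_inverse fg_one fg_inv fg_mul.
Proof.
move=> u; apply: val_inj => /=; rewrite -{1}(word_invK u).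
by rewrite -{2}(word_mulw1 (reduced_word_inv (freegroupP u))) word_mulVK.
Qed.

HB.instance Definition _ :=
  isGroup.Build freegroup fg_mulA fg_mul1 fg_mulr1 fg_mulV fg_mulrV.

End FreeGroup.

Section InducedMorphism.
Variables (Gamma : groupType) (S : choiceType) (x : S -> Gamma).

Definition letter_eval (l : letter S) : Gamma :=
  if l.1 then (x l.2)^-1 else x l.2.

Definition free_eval (w : freegroup S) : Gamma :=
  \prod_(l <- word w) letter_eval l.

Lemma free_eval1 : free_eval 1 = 1.
Proof. by rewrite /free_eval big_nil. Qed.

Lemma free_evalM : {morph free_eval : u v / u * v}.
Proof.
move=> [u ru] [v rv]; rewrite /free_eval /=; elim: u {ru} => [|l u IHu] /=.
  by rewrite big_nil mul1g.
rewrite big_cons -mulgA -IHu; case: (word_mul u v) => [|m w] /=.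
  by rewrite big_cons.
case: eqP => [->|_]; last by rewrite big_cons.
rewrite big_cons mulgA; have -> : letter_eval (letter_inv l) = (letter_eval l)^-1.
  by case: l => -[] a; rewrite /letter_eval /= ?invgK.
by rewrite mulgV mul1g.
Qed.

HB.instance Definition _ :=
  isUMagmaMorphism.Build (freegroup S) Gamma free_eval (free_eval1, free_evalM).

End InducedMorphism.

Section Codes.
Variable S : finType.

Definition code_letter (l : letter S) : nat := ((enum_rank l.2).*2 + l.1)%N.

Definition code_word (w : freegroup S) : nat :=
  CodeSeq.code [seq code_letter l | l <- word w].

(* Injective on nonnegative rationals, the only ones to be coded. *)
Definition code_rat (q : rat) : nat :=
  CodeSeq.code [:: `|numq q|%N; `|denq q|%N].

(* m is the code of a list of the elements of F, possibly with repetitions. *)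
Definition codes_fset (m : nat) (F : {fset freegroup S}) : Prop :=
  exists2 s : seq (freegroup S), s =i F & m = CodeSeq.code (map code_word s).

(* m is the code of a list of pairs (w, f w), with w ranging over a list
   that contains the support of f. *)
Definition codes_fsfun (m : nat) (f : {fsfun freegroup S -> rat with 0%R}) :
    Prop :=
  exists2 s : seq (freegroup S), {subset finsupp f <= s} &
    m = CodeSeq.code
          [seq CodeSeq.code [:: code_word w; code_rat (f w)] | w <- s].

Definition recursive_set (A : set (freegroup S)) : Prop :=
  exists2 u : nat -> nat, recursive1 u &
    forall w, u (code_word w) = nat_of_bool `[< A w >].

End Codes.

Section Amenability.
Variables (Gamma : groupType) (X : {fset Gamma}).

Definition ltranslate (x : Gamma) (Om : {fset Gamma}) : {fset Gamma} :=
  [fset x * g | g in Om]%fset.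

Definition folner (n : nat) (Om : {fset Gamma}) : Prop :=
  Om != fset0 /\
  forall x, x \in X ->
    (#|` (Om `\` ltranslate x Om)%fset |%:R / #|` Om |%:R <= n%:R^-1 :> rat)%R.

Definition amenable : Prop :=
  forall n : nat, (0 < n)%N -> exists Om, folner n Om.

(* None stands for infinity. *)
Definition folner_function (n : nat) : option nat :=
  match pselect (exists k, `[< exists2 Om, folner n Om & #|` Om | = k >]) with
  | left e => Some (ex_minn e)
  | right _ => None
  end.

Definition subrecursive_folner : Prop :=
  exists2 u : nat -> nat, recursive1 u &
    forall n : nat, (0 < n)%N ->
      exists2 k, folner_function n = Some k & (k <= u n)%N.

Definition n_invariant (R : realType) (n : nat) (h : Gamma -> R) : Prop :=
  [/\ forall g, (0 <= h g)%R,
      summable [set: Gamma] (fun g => (h g)%:E),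
      exists g, h g != 0%R
    & forall x, x \in X ->
      (\esum_(g in [set: Gamma]) (`|h g - h (x^-1 * g)%g|%R)%:E
         <= (n%:R^-1 : R)%:E * \esum_(g in [set: Gamma]) (h g)%:E)%E].

End Amenability.

Section Marked.
Variables (Gamma : groupType) (X : {fset Gamma}) (S : finType) (b : S -> X).

Definition marking : freegroup S -> Gamma := free_eval (fun a => val (b a)).

Definition recursively_presentable : Prop :=
  exists2 A : set (freegroup S), recursive_set A &
    normal_closure A = [set w | marking w = 1].

Definition computable_folner_superset : Prop :=
  exists2 u : nat -> nat, recursive1 u &
    forall n : nat, (0 < n)%N ->
      exists2 F : {fset freegroup S}, codes_fset (u n) F &
        exists2 Om, folner X n Om & (Om `<=` [fset marking w | w in F])%fset.

(* The sum over w is finitary: it is meant for finitely supported f. *)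
Definition pushforward (f : freegroup S -> rat) (g : Gamma) : rat :=
  (\sum_(w \in marking @^-1` [set g]) f w)%R.

Definition computable_reiter (R : realType) : Prop :=
  exists2 u : nat -> nat, recursive1 u &
    forall n : nat, (0 < n)%N ->
      exists f : {fsfun freegroup S -> rat with 0%R},
        [/\ codes_fsfun (u n) f, forall w, (0 <= f w)%R
          & n_invariant X n (fun g => ratr (pushforward f g) : R)].

End Marked.

(* Main.v *)
(** Cover the three computable conditions with a single search.  In a recursively
    presentable group, equality of words is semidecidable: a relation u = v has
    a finite derivation that inserts and deletes relators.  Hence it is
    semidecidable that a duplicate-free list s of k words, prolonged by a list j
    of at most k/(C n) words, satisfies: for each generator x there is an
    injection T with x s_i = (s ++ j)_(T i) in the group.  Such a certificate
    never needs an inequality in the group: the counting function h of the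
    images of s satisfies x h <= h + (counting function of j), so
    |h - x h|_1 <= 2 |j|, whatever the multiplicities are.  In an amenable group
    the search succeeds, as is seen by lifting a Folner set and its boundary.
    Its output is a Reiter function, and by the coarea argument of Namioka some
    level set of h is a Folner set, contained in the image of s; this gives
    (ii), (iii) and (iv).  Each of these implies (i), the last one by the coarea
    argument again. *)

Require Import Defs.
From HB Require Import structures.
From mathcomp Require Import all_boot all_order all_algebra.
From mathcomp Require Import finmap.
From mathcomp Require Import boolp classical_sets cardinality fsbigop reals ereal esum.
From mathcomp Require Import lra.
From Stdlib Require Import Relation_Operators Operators_Properties.

Set Implicit Arguments.
Unset Strict Implicit.
Unset Printing Implicit Defensive.

Import Order.TTheory GRing.Theory Num.Theory.

(** * Recursive functions and semidecidable predicates *)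

Section RecursiveFunctions.

(* Arguments are passed as a sequence, read only at size k, so that binders
   extend the argument list on the left without any dependent typing. *)
Definition recfun k (f : seq nat -> nat) : Prop :=
  recursive (fun v : k.-tuple nat => f v).

Lemma eq_recfun k f g : (forall v, size v = k -> f v = g v) ->
  recfun k f -> recfun k g.
Proof.
move=> fg; rewrite /recfun; congr recursive; apply/funext => v.
by rewrite fg // size_tuple.
Qed.

Lemma recfun_nth k i : i < k -> recfun k (fun v => nth 0 v i).
Proof.
move=> ik; have := recursive_proj (Ordinal ik); congr recursive.
by apply/funext => v; rewrite (tnth_nth 0).
Qed.

Lemma recfun_nthE k i f : (forall v, nth 0 v i = f v) -> i < k -> recfun k f.
Proof. by move=> /funext <-; exact: recfun_nth. Qed.

(** Kleene's composition, with the inner functions packed into one transformer [E] of argument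
    lists. Weakening, substitution and permutation of arguments are all instances. *)
Lemma recfun_env k m g (E : seq nat -> seq nat) :
  (forall v, size v = k -> size (E v) = m) ->
  (forall i, i < m -> recfun k (fun v => nth 0 (E v) i)) ->
  recfun m g -> recfun k (fun v => g (E v)).
Proof.
move=> sE rE rg.
have := recursive_comp rg (h := fun (i : 'I_m) (v : k.-tuple nat) => nth 0 (E v) i)
  (fun i => rE i (ltn_ord i)).
congr recursive; apply/funext => v; congr g.
apply: (@eq_from_nth _ 0); first by rewrite size_tuple sE ?size_tuple.
rewrite size_tuple => i im; rewrite (nth_map (Ordinal im)) ?size_enum_ord //.
by rewrite nth_enum_ord.
Qed.

Lemma recfun_head k : recfun k.+1 (fun v => head 0 v).
Proof. by apply: eq_recfun (recfun_nth (ltn0Sn k)) => -[]. Qed.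

Lemma recfun_weak k f : recfun k f -> recfun k.+1 (fun v => f (behead v)).
Proof.
apply: recfun_env => [v|i ik]; first by rewrite size_behead => ->.
by apply: (recfun_nthE (i := i.+1)) => [v|]; rewrite ?nth_behead ?ltnS.
Qed.

Lemma recfun_subst k f a : recfun k.+1 f -> recfun k a ->
  recfun k (fun v => f (a v :: v)).
Proof.
move=> rf ra; apply: recfun_env rf => [v /= -> //|[|i] ik //].
exact: recfun_nth.
Qed.

Lemma recfun_const k c : recfun k (fun=> c).
Proof.
have r0 : recfun k (fun=> 0).
  apply: (@recfun_env k 0 (fun=> 0) (fun=> [::])) => //.
  by have := recursive_zero.
elim: c => // c IHc; apply: (@recfun_env k 1 (fun v => (head 0 v).+1) (fun=> [:: c])).
- by [].
- by case.
- have := recursive_succ; congr recursive; apply/funext => v.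
  by rewrite /thead (tnth_nth 0) -nth0.
Qed.

Lemma recfun_succ k a : recfun k a -> recfun k (fun v => (a v).+1).
Proof.
move=> ra; apply: (@recfun_env k 1 (fun v => (head 0 v).+1) (fun v => [:: a v])).
- by [].
- by case.
- have := recursive_succ; congr recursive; apply/funext => v.
  by rewrite /thead (tnth_nth 0) -nth0.
Qed.

Lemma recfun_nat_rect k g h b : recfun k g -> recfun k.+2 h -> recfun k b ->
  recfun k (fun v => nat_rect (fun=> nat) (g v) (fun i r => h [:: i, r & v]) (b v)).
Proof.
move=> rg rh; have rr := recursive_primrec rg rh.
(* The recursion scheme consumes the first argument, so the bound is first a fresh head of the list
   and is then replaced by [b v]. *)
pose f v := nat_rect (fun=> nat) (g (behead v))
  (fun i r => h [:: i, r & behead v]) (head 0 v).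
have rf : recfun k.+1 f.
  move: rr; congr recursive; apply/funext => v.
  by rewrite /f /thead (tnth_nth 0) -nth0.
exact: (@recfun_subst k f b).
Qed.

Lemma recfun_iter k h b c : recfun k.+1 h -> recfun k b -> recfun k c ->
  recfun k (fun v => iter (b v) (fun r => h (r :: v)) (c v)).
Proof.
move=> rh rb rc.
apply: eq_recfun (recfun_nat_rect (h := fun w => h (behead w)) rc _ rb) => [v _|].
  by elim: (b v) => //= n ->.
exact: recfun_weak.
Qed.

Lemma recfun_add k a b : recfun k a -> recfun k b ->
  recfun k (fun v => a v + b v).
Proof.
move=> ra rb; apply: eq_recfun (recfun_iter (h := fun w => (head 0 w).+1) _ ra rb).
  by move=> v _; elim: (a v) => //= n ->.
exact: (recfun_succ (recfun_head _)).
Qed.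

Lemma recfun_mul k a b : recfun k a -> recfun k b ->
  recfun k (fun v => a v * b v).
Proof.
move=> ra rb.
apply: eq_recfun (recfun_iter (h := fun w => b (behead w) + head 0 w) _ ra (recfun_const k 0)).
  by move=> v _; elim: (a v) => //= n ->.
exact: (recfun_add (recfun_weak rb) (recfun_head _)).
Qed.

Lemma recfun_exp k a b : recfun k a -> recfun k b ->
  recfun k (fun v => a v ^ b v).
Proof.
move=> ra rb.
apply: eq_recfun (recfun_iter (h := fun w => a (behead w) * head 0 w) _ rb (recfun_const k 1)).
  by move=> v _; elim: (b v) => //= n ->; rewrite expnS.
exact: (recfun_mul (recfun_weak ra) (recfun_head _)).
Qed.

Lemma recfun_pred k a : recfun k a -> recfun k (fun v => (a v).-1).
Proof.
move=> ra; apply: eq_recfun (recfun_nat_rect (g := fun=> 0) (h := fun w => head 0 w) _ _ ra).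
- by move=> v _; case: (a v).
- exact: recfun_const.
- exact: recfun_head.
Qed.

Lemma recfun_sub k a b : recfun k a -> recfun k b ->
  recfun k (fun v => a v - b v).
Proof.
move=> ra rb; apply: eq_recfun (recfun_iter (h := fun w => (head 0 w).-1) _ rb ra).
  by move=> v _; elim: (b v) => [|n /= ->]; rewrite ?subn0 ?subnS.
exact: (recfun_pred (recfun_head _)).
Qed.

Lemma recfun_sum k g b : recfun k.+1 g -> recfun k b ->
  recfun k (fun v => \sum_(i < b v) g (val i :: v)).
Proof.
move=> rg rb; apply: eq_recfun (recfun_nat_rect (g := fun=> 0)
  (h := fun w => nth 0 w 1 + g (nth 0 w 0 :: behead (behead w))) _ _ rb).
- by move=> v _; elim: (b v) => [|n /= ->]; rewrite ?big_ord0 ?big_ord_recr.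
- exact: recfun_const.
- apply: recfun_add; first exact: recfun_nth.
  apply: (recfun_env (E := fun w => nth 0 w 0 :: behead (behead w)) _ _ rg) => [v /= |[|i] ik /=].
  + by rewrite !size_behead => ->.
  + exact: recfun_nth.
  + by apply: (recfun_nthE (i := i.+2)) => [v|]; rewrite ?nth_behead ?ltnS.
Qed.

Lemma recfun_prod k g b : recfun k.+1 g -> recfun k b ->
  recfun k (fun v => \prod_(i < b v) g (val i :: v)).
Proof.
move=> rg rb; apply: eq_recfun (recfun_nat_rect (g := fun=> 1)
  (h := fun w => nth 0 w 1 * g (nth 0 w 0 :: behead (behead w))) _ _ rb).
- by move=> v _; elim: (b v) => [|n /= ->]; rewrite ?big_ord0 ?big_ord_recr.
- exact: recfun_const.
- apply: recfun_mul; first exact: recfun_nth.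
  apply: (recfun_env (E := fun w => nth 0 w 0 :: behead (behead w)) _ _ rg) => [v /= |[|i] ik /=].
  + by rewrite !size_behead => ->.
  + exact: recfun_nth.
  + by apply: (recfun_nthE (i := i.+2)) => [v|]; rewrite ?nth_behead ?ltnS.
Qed.

Lemma recfun_mu k g : recfun k.+1 g ->
  (forall v, size v = k -> exists y, g (y :: v) = 0) ->
  exists2 f, recfun k f & forall v, size v = k -> g (f v :: v) = 0.
Proof.
move=> rg ex_g.
(* [f v] is the least zero, as the regularity condition of [recursive_mu] demands. On lists of the
   wrong length the value is arbitrary. *)
have /choice[f fP] (v : seq nat) : exists y, size v = k ->
    g (y :: v) = 0 /\ forall i, i < y -> g (i :: v) <> 0.
  have [sv|nsv] := pselect (size v = k); last by exists 0.
  have ex : exists y, g (y :: v) == 0 by have [y /eqP] := ex_g _ sv; exists y.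
  case: (ex_minnP ex) => y /eqP gy miny; exists y => _; split=> // i iy /eqP gi.
  by have := miny _ gi; rewrite leqNgt iy.
exists f; last by move=> v /fP[].
apply: (recursive_mu rg) => v; apply: fP; exact: size_tuple.
Qed.

Lemma recfun1P u : recursive1 u <-> recfun 1 (fun v => u (head 0 v)).
Proof.
rewrite /recursive1 /recfun.
suff -> : (fun v : 1.-tuple nat => u (thead v)) = fun v : 1.-tuple nat => u (head 0 v) by [].
by apply/funext => v; rewrite /thead (tnth_nth 0) -nth0.
Qed.

Lemma recfun_app1 k u a : recursive1 u -> recfun k a ->
  recfun k (fun v => u (a v)).
Proof.
move=> /recfun1P ru ra.
by apply: (@recfun_env k 1 _ (fun v => [:: a v]) _ _ ru) => // -[].
Qed.

End RecursiveFunctions.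

Section SemidecidablePredicates.

(** A $\Sigma^0_1$ predicate, as the projection of the zero set of a total recursive function; [p]
    acts as a certificate. *)
Definition semidec k (P : seq nat -> Prop) : Prop :=
  exists2 g, recfun k.+1 g &
    forall v, size v = k -> P v <-> exists p, g (p :: v) = 0.

Lemma eq_semidec k P Q : (forall v, size v = k -> P v <-> Q v) ->
  semidec k P -> semidec k Q.
Proof.
move=> PQ [g rg gP]; exists g => // v sv; rewrite -gP //; split; apply PQ => //.
Qed.

Lemma semidec_eq k a b : recfun k a -> recfun k b ->
  semidec k (fun v => a v = b v).
Proof.
move=> ra rb; exists (fun w => (a (behead w) - b (behead w)) + (b (behead w) - a (behead w))).
  by apply: recfun_add; apply: recfun_sub; apply: recfun_weak.
move=> v _ /=; split=> [->|[_ /eqP]]; first by exists 0; rewrite subnn.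
by rewrite addn_eq0 !subn_eq0 -eqn_leq => /eqP.
Qed.

Lemma semidec_leq k a b : recfun k a -> recfun k b ->
  semidec k (fun v => a v <= b v).
Proof.
move=> ra rb; exists (fun w => a (behead w) - b (behead w)).
  by apply: recfun_sub; apply: recfun_weak.
move=> v _ /=; rewrite -subn_eq0.
by split=> [/eqP ->|[_ ->]]; first exists 0.
Qed.

Lemma prodn_eq0P (n : nat) (F : nat -> nat) :
  \prod_(i < n) F i = 0 <-> exists2 i, i < n & F i = 0.
Proof.
split=> [/eqP|[i ni Fi]]; last by rewrite (bigD1 (Ordinal ni)) //= Fi.
elim: n => [|n IHn]; first by rewrite big_ord0.
rewrite big_ord_recr muln_eq0 => /orP[/IHn[i /ltnW]|/eqP]; first by exists i.
by exists n.
Qed.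

(** One number bounds both the witness and its certificate: the double product vanishes exactly when
    some pair below the bound works. This replaces a pairing function. *)
Lemma semidec_ex k P : semidec k.+1 (fun w => P (head 0 w) (behead w)) ->
  semidec k (fun v => exists x, P x v).
Proof.
case=> g rg gP.
exists (fun w => \prod_(x < head 0 w) \prod_(p < head 0 w)
    g [:: val p, val x & behead w]).
  apply: (@recfun_prod _ (fun w => \prod_(p < nth 0 w 1)
      g [:: val p, head 0 w & behead (behead w)])); last exact: recfun_head.
  apply: (@recfun_prod _ (fun w => g [:: head 0 w, nth 0 w 1 & behead (behead (behead w))])); last exact: recfun_nth.
  apply: (recfun_env _ _ rg) => [v|[|[|i]] ik /=].
  - by rewrite /= !size_behead => ->.
  - exact: recfun_head.
  - exact: recfun_nth.
  - by apply: (recfun_nthE (i := i.+3)) => [v|]; rewrite ?nth_behead ?ltnS.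
move=> v sv; have gP' x := gP (x :: v) (f_equal S sv); split=> /= [[x Pxv]|[m]].
  have [p gp] := (gP' x).1 Pxv.
  exists (maxn x p).+1; apply/(prodn_eq0P _ (fun x => \prod_(p < _) g [:: val p, x & v])).
  exists x; first by rewrite ltnS leq_maxl.
  apply/(prodn_eq0P _ (fun p => g [:: p, x & v])).
  by exists p; first by rewrite ltnS leq_maxr.
move/(prodn_eq0P _ (fun x => \prod_(p < _) g [:: val p, x & v])) => [x _].
move/(prodn_eq0P _ (fun p => g [:: p, x & v])) => [p _ gp].
by exists x; apply/gP'; exists p.
Qed.

(** The new certificate is a common bound for the finitely many certificates, one for each
    [i < b v]. A sum of products vanishes when every product contains a zero factor. *)
Lemma semidec_all k P b :
  semidec k.+1 (fun w => P (head 0 w) (behead w)) -> recfun k b ->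
  semidec k (fun v => forall i, i < b v -> P i v).
Proof.
case=> g rg gP rb.
exists (fun w => \sum_(i < b (behead w)) \prod_(p < head 0 w)
    g [:: val p, val i & behead w]).
  apply: (@recfun_sum _ (fun w => \prod_(p < nth 0 w 1)
      g [:: val p, head 0 w & behead (behead w)])); last exact: recfun_weak.
  apply: (@recfun_prod _ (fun w => g [:: head 0 w, nth 0 w 1 & behead (behead (behead w))])); last exact: recfun_nth.
  apply: (recfun_env _ _ rg) => [v|[|[|i]] ik /=].
  - by rewrite /= !size_behead => ->.
  - exact: recfun_head.
  - exact: recfun_nth.
  - by apply: (recfun_nthE (i := i.+3)) => [v|]; rewrite ?nth_behead ?ltnS.
move=> v sv; have gP' x := gP (x :: v) (f_equal S sv); split=> /= [Pv|[m]].
  have /choice[q qP] i : exists p, i < b v -> g [:: p, i & v] = 0.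
    have [ib|_] := boolP (i < b v); last by exists 0.
    by have [p gp] := (gP' i).1 (Pv i ib); exists p.
  exists (\max_(i < b v) q i).+1; apply: big1 => i _.
  apply/(prodn_eq0P _ (fun p => g [:: p, val i & v])); exists (q i); last exact: qP.
  by rewrite ltnS (leq_bigmax i).
move=> sum0 i ib; apply/gP'.
have /(prodn_eq0P _ (fun p => g [:: p, i & v])) [p _ gp] : \prod_(p < m) g [:: val p, i & v] = 0.
  by apply/eqP; move/eqP: sum0; rewrite sum_nat_eq0 => /forallP/(_ (Ordinal ib)).
by exists p.
Qed.

Lemma semidec_and k P Q : semidec k P -> semidec k Q ->
  semidec k (fun v => P v /\ Q v).
Proof.
move=> [g rg gP] [h rh hP].
apply: (@eq_semidec _ (fun v => exists p, exists q, g (p :: v) + h (q :: v) = 0)).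
  move=> v sv; rewrite gP ?hP //; split=> [[p [q /eqP]]|[[p gp] [q hq]]].
    by rewrite addn_eq0 => /andP[/eqP gp /eqP hq]; split; [exists p|exists q].
  by exists p, q; rewrite gp hq.
apply: semidec_ex; apply: semidec_ex; apply: semidec_eq (recfun_const _ _).
apply: recfun_add.
  apply: (recfun_env _ _ rg) => [v|[|i] ik /=].
  - by rewrite /= !size_behead => ->.
  - exact: (recfun_weak (recfun_head _)).
  - by apply: (recfun_nthE (i := i.+2)) => [v|]; rewrite ?nth_behead ?ltnS.
apply: (recfun_env _ _ rh) => [v|[|i] ik /=].
- by rewrite /= !size_behead => ->.
- exact: recfun_head.
- by apply: (recfun_nthE (i := i.+2)) => [v|]; rewrite ?nth_behead ?ltnS.
Qed.

Lemma semidec_or k P Q : semidec k P -> semidec k Q ->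
  semidec k (fun v => P v \/ Q v).
Proof.
move=> [g rg gP] [h rh hP]; exists (fun w => g w * h w); first exact: recfun_mul.
move=> v sv; rewrite gP ?hP //; split=> [[[p gp]|[p hp]]|[p /eqP]].
- by exists p; rewrite gp.
- by exists p; rewrite hp muln0.
- by rewrite muln_eq0 => /orP[]/eqP; [left|right]; exists p.
Qed.

Lemma semidec_neq k a b : recfun k a -> recfun k b ->
  semidec k (fun v => a v <> b v).
Proof.
move=> ra rb; apply: (@eq_semidec _ (fun v => (a v).+1 <= b v \/ (b v).+1 <= a v)).
  by move=> v _; rewrite (rwP eqP) (rwP negP) neq_ltn (rwP orP).
by apply: semidec_or; apply: semidec_leq => //; apply: recfun_succ.
Qed.

(** Two minimizations. The first finds a [stage] below which some value and its certificate both
    occur; the second finds the least value having a certificate below that stage. Both searches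
    succeed, so they are regular. *)
Lemma semidec_uniformization k P : semidec k.+1 P ->
  (forall v, size v = k -> exists y, P (y :: v)) ->
  exists2 f, recfun k f & forall v, size v = k -> P (f v :: v).
Proof.
case=> g rg gP exP.
have rh : recfun k.+2 (fun w => \prod_(p < nth 0 w 1) g [:: val p, head 0 w & behead (behead w)]).
  apply: (@recfun_prod _ (fun w => g [:: head 0 w, nth 0 w 1 & behead (behead (behead w))])); last exact: recfun_nth.
  apply: (recfun_env _ _ rg) => [v|[|[|i]] ik /=].
  - by rewrite /= !size_behead => ->.
  - exact: recfun_head.
  - exact: recfun_nth.
  - by apply: (recfun_nthE (i := i.+3)) => [v|]; rewrite ?nth_behead ?ltnS.
have [stage rs sP] : exists2 f, recfun k f & forall v, size v = k ->
    \prod_(y < f v) \prod_(p < f v) g [:: val p, val y & v] = 0.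
  apply: (recfun_mu (g := fun w => \prod_(y < head 0 w) \prod_(p < head 0 w)
      g [:: val p, val y & behead w])).
    by apply: recfun_prod rh _; exact: recfun_head.
  move=> v sv; have [y /gP[/=|p gp]] := exP v sv; first by rewrite sv.
  exists (maxn y p).+1; apply/(prodn_eq0P _ (fun x => \prod_(p < _) g [:: val p, x & v])).
  exists y; first by rewrite ltnS leq_maxl.
  apply/(prodn_eq0P _ (fun p => g [:: p, y & v])).
  by exists p; first by rewrite ltnS leq_maxr.
have [f rf fP] : exists2 f, recfun k f & forall v, size v = k ->
    \prod_(p < stage v) g [:: val p, f v & v] = 0.
  apply: (recfun_mu (g := fun w => \prod_(p < stage (behead w)) g (val p :: w))).
    by apply: recfun_prod => //; exact: recfun_weak.
  move=> v sv; have := sP v sv.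
  by move/(prodn_eq0P _ (fun x => \prod_(p < _) g [:: val p, x & v])) => [y _]; exists y.
exists f => // v sv; apply/gP; first by rewrite /= sv.
by have /(prodn_eq0P _ (fun p => g [:: p, f v & v])) [p _] := fP v sv; exists p.
Qed.

(* Lets one define a recursive function by describing its graph. *)
Lemma recfun_graph k f : semidec k.+1 (fun w => head 0 w = f (behead w)) ->
  recfun k f.
Proof.
move=> /semidec_uniformization [|h rh hP]; first by move=> v _; exists (f v).
by apply: eq_recfun rh => v /hP.
Qed.

Lemma semidec_choose (P : nat -> nat -> Prop) :
  semidec 2 (fun v => P (head 0 v) (head 0 (behead v))) -> (forall n, exists c, P c n) ->
  exists2 u, recursive1 u & forall n, P (u n) n.
Proof.
move=> sdP exP; have [|f rf fP] := semidec_uniformization sdP.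
  by move=> v _; exact: exP.
exists (fun n => f [:: n]) => [|n]; last exact: (fP [:: n]).
by apply/recfun1P; apply: eq_recfun rf => -[|n []].
Qed.

End SemidecidablePredicates.

(** * Recursive operations on coded sequences *)

Section RecursiveSequences.

Definition recseq k (F : seq nat -> seq nat) : Prop :=
  recfun k (fun v => CodeSeq.code (F v)).

Lemma recseq_weak k F : recseq k F -> recseq k.+1 (fun v => F (behead v)).
Proof. exact: recfun_weak. Qed.

Ltac recf := repeat first
  [ assumption | exact: recfun_const | exact: recfun_head
  | match goal with
    | |- recfun ?k (fun w => CodeSeq.code (@?F w)) => change (recseq k F)
    | |- recseq _ (fun w => ?F (behead (@?g w))) =>
        apply: (recseq_weak (F := fun v => F (g v)))
    | |- recseq _ (fun w => ?F (behead w)) => apply: (recseq_weak (F := F))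
    | |- recfun _ (fun w => ?F (behead (@?g w))) =>
        apply: (recfun_weak (f := fun v => F (g v)))
    | |- recfun _ (fun w => ?F (behead w)) => apply: (recfun_weak (f := F))
    end
  | apply: recfun_succ | apply: recfun_add | apply: recfun_mul
  | apply: recfun_exp | apply: recfun_sub ].

Lemma recseq_decode k a : recfun k a -> recseq k (fun v => CodeSeq.decode (a v)).
Proof. by apply: eq_recfun => v _; rewrite CodeSeq.decodeK. Qed.

Lemma recseq_const k s : recseq k (fun=> s).
Proof. exact: recfun_const. Qed.

(** By definition the code of [x :: s] is $2^x(2c+1)$, where $c$ is the code of [s]; the empty
    sequence has code 0. *)
Lemma recseq_cons k a F : recfun k a -> recseq k F ->
  recseq k (fun v => a v :: F v).
Proof.
move=> ra rF; apply: (@eq_recfun _ (fun v => 2 ^ a v * (2 * CodeSeq.code (F v)).+1)).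
  by move=> v _ /=; rewrite mul2n.
by recf.
Qed.

Lemma code_eq0 s : CodeSeq.code s = 0 <-> s = [::].
Proof. by split=> [|->//]; rewrite -[0]/(CodeSeq.code [::]) => /(can_inj CodeSeq.codeK). Qed.

(** A nonzero code is $2^h(2t+1)$ in exactly one way, and this equation already describes the graph
    of the head. The tail is treated in the same way below. *)
Lemma recfun_seq_head k F : recseq k F -> recfun k (fun v => head 0 (F v)).
Proof.
move=> rF; apply: recfun_graph.
apply: (@eq_semidec _ (fun w => (CodeSeq.code (F (behead w)) = 0 /\ head 0 w = 0) \/
   exists t, CodeSeq.code (F (behead w)) = 2 ^ head 0 w * (2 * t).+1)).
  move=> w _; case Fw: (F (behead w)) => [|x s] /=; last rewrite -mul2n; split.
  - by case=> [[]//|[t /eqP]]; rewrite eq_sym muln_eq0 expn_eq0.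
  - by left.
  - case=> [[/eqP]|[t]]; first by rewrite muln_eq0 expn_eq0.
    rewrite mul2n -[2 ^ x * _]/(CodeSeq.code (x :: s)) -[t]CodeSeq.decodeK mul2n.
    rewrite -[2 ^ _ * _]/(CodeSeq.code (head 0 w :: CodeSeq.decode t)).
    by move=> /(can_inj CodeSeq.codeK)[].
  - by move=> ->; right; exists (CodeSeq.code s).
apply: semidec_or; last apply: semidec_ex.
  by apply: semidec_and; apply: semidec_eq; recf.
by apply: semidec_eq; recf.
Qed.

Lemma recseq_behead k F : recseq k F -> recseq k (fun v => behead (F v)).
Proof.
move=> rF; apply: recfun_graph.
apply: (@eq_semidec _ (fun w => (CodeSeq.code (F (behead w)) = 0 /\ head 0 w = 0) \/
   exists h, CodeSeq.code (F (behead w)) = 2 ^ h * (2 * head 0 w).+1)).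
  move=> w _; case Fw: (F (behead w)) => [|x s] /=; last rewrite -mul2n; split.
  - by case=> [[]//|[t /eqP]]; rewrite eq_sym muln_eq0 expn_eq0.
  - by left.
  - case=> [[/eqP]|[t]]; first by rewrite muln_eq0 expn_eq0.
    rewrite mul2n -[2 ^ x * _]/(CodeSeq.code (x :: s)) -[head 0 w]CodeSeq.decodeK mul2n.
    rewrite -[2 ^ _ * _]/(CodeSeq.code (t :: CodeSeq.decode (head 0 w))).
    by move=> /(can_inj CodeSeq.codeK)[_ <-].
  - by move=> ->; right; exists x.
apply: semidec_or; last apply: semidec_ex.
  by apply: semidec_and; apply: semidec_eq; recf.
by apply: semidec_eq; recf.
Qed.

Lemma recseq_drop k i F : recfun k i -> recseq k F ->
  recseq k (fun v => drop (i v) (F v)).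
Proof.
move=> ri rF; apply: eq_recfun (recfun_iter
  (h := fun w => CodeSeq.code (behead (CodeSeq.decode (head 0 w)))) _ ri rF).
  move=> v _; elim: (i v) => [|n /= ->]; first by rewrite drop0.
  by rewrite CodeSeq.codeK -drop1 drop_drop.
by apply: (recseq_behead (F := fun w => CodeSeq.decode (head 0 w))); recf; apply: recseq_decode; recf.
Qed.

Lemma recfun_seq_nth k i F : recfun k i -> recseq k F ->
  recfun k (fun v => nth 0 (F v) (i v)).
Proof.
move=> ri rF; apply: eq_recfun (recfun_seq_head (recseq_drop ri rF)) => v _.
by rewrite -nth0 nth_drop addn0.
Qed.

(** The size is the least number of entries whose removal empties the sequence; [drop] is available
    as iterated [behead]. *)
Lemma recfun_size k F : recseq k F -> recfun k (fun v => size (F v)).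
Proof.
move=> rF; apply: recfun_graph.
apply: (@eq_semidec _ (fun w => CodeSeq.code (drop (head 0 w) (F (behead w))) = 0 /\
   forall i, i < head 0 w -> CodeSeq.code (drop i (F (behead w))) <> 0)).
  move=> w _; move: (head 0 w) (F _) => n s; rewrite code_eq0; split=> [[sn ltn]|->].
    have := f_equal size sn; rewrite size_drop => /eqP; rewrite subn_eq0 => le_sn.
    apply/eqP; rewrite eqn_leq le_sn andbT leqNgt; apply/negP => lt_sn.
    by apply: (ltn _ lt_sn); rewrite drop_size.
  split=> [|i]; first exact: drop_size.
  by rewrite code_eq0 -subn_gt0 -size_drop; case: drop.
apply: semidec_and; first apply: semidec_eq; recf.
  by apply: recseq_drop (recfun_head _) (recseq_weak rF).
apply: semidec_all; last exact: recfun_head.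
apply: semidec_neq; last by recf.
by apply: recseq_drop (recfun_head _) (recseq_weak (recseq_weak rF)).
Qed.

(** The graph pins down a concatenation by its length and its entries, all of them bounded
    conditions. *)
Lemma recseq_cat k F G : recseq k F -> recseq k G ->
  recseq k (fun v => F v ++ G v).
Proof.
move=> rF rG; apply: recfun_graph.
pose s w := CodeSeq.decode (head 0 w).
apply: (@eq_semidec _ (fun w =>
  size (s w) = size (F (behead w)) + size (G (behead w)) /\
  (forall i, i < size (F (behead w)) -> nth 0 (s w) i = nth 0 (F (behead w)) i) /\
  (forall i, i < size (G (behead w)) ->
     nth 0 (s w) (size (F (behead w)) + i) = nth 0 (G (behead w)) i))).
  move=> w _; move: (F _) (G _) => x y; rewrite -[head 0 w]CodeSeq.decodeK.
  rewrite -/(s w); move: (s w) => z.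
  split=> [[sz [zx zy]]|/(can_inj CodeSeq.codeK) ->].
    congr CodeSeq.code; apply: (@eq_from_nth _ 0) => [|i]; first by rewrite size_cat.
    rewrite sz => iz.
    rewrite nth_cat; case: ltnP => xi; first exact: zx.
    by rewrite -[in LHS](subnKC xi) zy // ltn_subLR.
  rewrite size_cat; split=> //; split=> i ik; rewrite nth_cat ?ik //.
  by rewrite ltnNge leq_addr /= addKn.
have rs m : recseq m.+1 s by apply: recseq_decode; exact: recfun_head.
have rbF := recseq_weak rF; have rbG := recseq_weak rG.
apply: semidec_and; first apply: semidec_eq.
- exact: recfun_size.
- by apply: recfun_add; exact: recfun_size.
- apply: semidec_and.
    apply: semidec_all; last exact: recfun_size.
    apply: semidec_eq; first exact: recfun_seq_nth (recfun_head _) (recseq_weak (rs _)).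
    exact: recfun_seq_nth (recfun_head _) (recseq_weak rbF).
  apply: semidec_all; last exact: recfun_size.
  apply: semidec_eq; last exact: recfun_seq_nth (recfun_head _) (recseq_weak rbG).
  apply: recfun_seq_nth _ (recseq_weak (rs _)).
  exact: recfun_add (recfun_size (recseq_weak rbF)) (recfun_head _).
Qed.

Lemma semidec_ex_seq k (P : seq nat -> seq nat -> Prop) :
  semidec k.+1 (fun w => P (CodeSeq.decode (head 0 w)) (behead w)) ->
  semidec k (fun v => exists s, P s v).
Proof.
move=> sP; apply: (@eq_semidec _ (fun v => exists c, P (CodeSeq.decode c) v)).
  move=> v _; split=> [[c]|[s]]; first by exists (CodeSeq.decode c).
  by exists (CodeSeq.code s); rewrite CodeSeq.codeK.
exact: semidec_ex.
Qed.

Lemma semidec_eq_seq k F G : recseq k F -> recseq k G ->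
  semidec k (fun v => F v = G v).
Proof.
move=> rF rG; apply: eq_semidec (semidec_eq rF rG) => v _.
by split=> [/(can_inj CodeSeq.codeK)|->].
Qed.

Lemma semidec_uniq k F : recseq k F -> semidec k (fun v => uniq (F v)).
Proof.
move=> rF; apply: (@eq_semidec _ (fun v => forall i, i < size (F v) ->
   forall j, j < i -> nth 0 (F v) i <> nth 0 (F v) j)).
  move=> v _; move: (F v) => s; split=> [neq_s|us i si j ji].
    apply/(uniqP 0) => i j; rewrite !inE => si sj eq_ij.
    by case: (ltngtP i j) => // [/(neq_s _ sj)|/(neq_s _ si)]; rewrite eq_ij.
  move/eqP; rewrite nth_uniq // ?(gtn_eqF ji) //; exact: ltn_trans ji si.
have rF1 := recseq_weak rF; have rF2 := recseq_weak rF1.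
apply: semidec_all (recfun_size rF); apply: semidec_all (recfun_head _).
apply: semidec_neq; last exact: recfun_seq_nth (recfun_head _) rF2.
exact: recfun_seq_nth (recfun_weak (recfun_head _)) rF2.
Qed.

End RecursiveSequences.

(** Syntax-directed search through the closure lemmas. The cases with [behead] come first: a term
    living under several binders is reached by undoing weakenings. *)
Ltac semi_step := first
  [ assumption
  | lazymatch goal with
    | |- recseq _ (fun w => ?F (behead (@?g w))) =>
        apply: (recseq_weak (F := fun v => F (g v)))
    | |- recseq _ (fun w => ?F (behead w)) => apply: (recseq_weak (F := F))
    | |- recseq _ _ => first [exact: recseq_const | apply: recseq_cons
        | apply: recseq_cat | apply: recseq_decode]
    | |- recfun ?k (fun w => CodeSeq.code (@?F w)) => change (recseq k F)
    | |- recfun _ (fun w => head 0 (behead (@?g w))) =>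
        apply: (recfun_weak (f := fun v => head 0 (g v)))
    | |- recfun _ (fun w => head 0 (behead w)) =>
        apply: (recfun_weak (f := fun v => head 0 v))
    | |- recfun _ (fun w => ?F (behead (@?g w))) =>
        apply: (recfun_weak (f := fun v => F (g v)))
    | |- recfun _ (fun w => ?F (behead w)) => apply: (recfun_weak (f := F))
    | |- recfun _ _ => first [exact: recfun_head | exact: recfun_const
        | apply: recfun_succ | apply: recfun_add | apply: recfun_mul
        | apply: recfun_exp | apply: recfun_pred | apply: recfun_sub
        | apply: recfun_size | apply: recfun_seq_nth]
    | |- semidec _ _ => first [apply: semidec_and | apply: semidec_or
        | apply: semidec_all | apply: semidec_ex_seq | apply: semidec_ex
        | apply: semidec_eq_seq | apply: semidec_eq | apply: semidec_leq
        | apply: semidec_neq | apply: semidec_uniq]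
    end ].

Ltac semi := repeat semi_step.

(** * String rewriting by insertion and deletion of relators *)

Section Conversion.

Variable relator : seq nat -> Prop.

(** Words are unreduced lists of numbers here, multiplied by concatenation, so that a relator can be
    inserted at any place. *)
Definition insertion (a b : seq nat) : Prop :=
  exists p, exists q, exists r, relator r /\ (a = p ++ q /\ b = p ++ r ++ q).

Definition conversion := clos_refl_sym_trans _ insertion.

Lemma insertion_cat p q a b : insertion a b -> insertion (p ++ a ++ q) (p ++ b ++ q).
Proof.
case=> x [y [r [rr [-> ->]]]]; exists (p ++ x), (y ++ q), r.
by rewrite -!catA.
Qed.

Lemma conversion_cat p q a b :
  conversion a b -> conversion (p ++ a ++ q) (p ++ b ++ q).
Proof.
elim=> [x y /(insertion_cat p q)|x|x y _|x y z _ xy _ yz].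
- exact: rst_step.
- exact: rst_refl.
- exact: rst_sym.
- exact: rst_trans xy yz.
Qed.

(** Linearizing the closure turns a derivation into a finite chain [c] of codes: one existential
    quantifier over sequences followed by bounded checks. *)
Lemma conversionP a b : conversion a b <->
  exists c, nth 0 c 0 = CodeSeq.code a /\
    (nth 0 c (size c).-1 = CodeSeq.code b /\
    forall i, i < (size c).-1 ->
      insertion (CodeSeq.decode (nth 0 c i)) (CodeSeq.decode (nth 0 c i.+1)) \/
      insertion (CodeSeq.decode (nth 0 c i.+1)) (CodeSeq.decode (nth 0 c i))).
Proof.
split=> [ab|].
  elim: (clos_rst_rst1n _ _ _ _ ab) => [x|x y z xy _ [[|e c] /= [cy [cz cP]]]].
  - by exists [:: CodeSeq.code x].
  (* An empty chain reads as the default 0, which is the code of the empty word, so it certifies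
     that [y] and [z] are both empty. *)
  - exists [:: CodeSeq.code x; CodeSeq.code y]; do !split=> //=; first by rewrite -cy -cz.
    by case=> [_|[]//]; rewrite /= !CodeSeq.codeK.
  - exists [:: CodeSeq.code x, e & c]; do !split=> //=.
    by case=> [_|i /cP//]; rewrite /= cy !CodeSeq.codeK.
case=> c [c0 [cl cP]].
suff conv_c i : i <= (size c).-1 -> conversion a (CodeSeq.decode (nth 0 c i)).
  by rewrite -[b]CodeSeq.codeK -cl; exact: conv_c.
elim: i => [_|i IHi ic]; first by rewrite c0 CodeSeq.codeK; exact: rst_refl.
apply: rst_trans (IHi (ltnW ic)) _.
by case: (cP i ic) => h; [apply: rst_step | apply: rst_sym; apply: rst_step].
Qed.

Hypothesis semidec_relator : forall k F, recseq k F ->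
  semidec k (fun v => relator (F v)).

Lemma semidec_insertion k F G : recseq k F -> recseq k G ->
  semidec k (fun v => insertion (F v) (G v)).
Proof.
by move=> rF rG; rewrite /insertion; do 3!apply: semidec_ex_seq;
  apply: semidec_and; [apply: semidec_relator|]; semi.
Qed.

Lemma semidec_conversion k F G : recseq k F -> recseq k G ->
  semidec k (fun v => conversion (F v) (G v)).
Proof.
move=> rF rG; apply: eq_semidec => [v _|]; first by rewrite conversionP; apply: iff_refl.
by repeat first [apply: semidec_insertion | semi_step].
Qed.

End Conversion.

(** * Derivations between words *)

Section WordCodes.

Variable S : finType.
Implicit Types (u v w : freegroup S).

Definition code_letters (w : seq (letter S)) : seq nat := map (@code_letter S) w.

Lemma code_wordE w : code_word w = CodeSeq.code (code_letters w).
Proof. by []. Qed.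

(* The parity of a letter code is the sign of the letter. *)
Definition code_inv (c : nat) : nat := if odd c then c.-1 else c.+1.

Lemma code_letter_half (l : letter S) : (code_letter l)./2 = enum_rank l.2.
Proof. by rewrite /code_letter addnC half_bit_double. Qed.

Lemma code_letter_odd (l : letter S) : odd (code_letter l) = l.1.
Proof. by rewrite /code_letter oddD odd_double oddb. Qed.

Lemma code_letter_inj : injective (@code_letter S).
Proof.
move=> [c x] [d y] e; have := code_letter_odd (c, x); have := code_letter_half (c, x).
rewrite e code_letter_odd code_letter_half /= => /ord_inj/enum_rank_inj -> ->//.
Qed.

Lemma code_letters_inj : injective code_letters.
Proof. exact: inj_map code_letter_inj. Qed.

Lemma code_word_inj : injective (@code_word S).
Proof. by move=> u v /(can_inj CodeSeq.codeK)/code_letters_inj/val_inj. Qed.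

Lemma code_letter_inv (l : letter S) : code_letter (letter_inv l) = code_inv (code_letter l).
Proof.
rewrite /code_inv code_letter_odd; case: l => -[] x; rewrite /code_letter /=.
  by rewrite addn1 addn0.
by rewrite addn1 addn0.
Qed.

Lemma code_letter_lt (l : letter S) : code_letter l < 2 * #|S|.
Proof.
rewrite mul2n /code_letter (leq_trans (n := (enum_rank l.2).+1.*2)) ?leq_double //.
by rewrite doubleS addnC; case: l => -[].
Qed.

Lemma code_letter_surj c : c < 2 * #|S| -> exists l : letter S, c = code_letter l.
Proof.
move=> cS; have c2 : c./2 < #|S| by rewrite ltn_half_double -mul2n.
exists (odd c, enum_val (Ordinal c2)); rewrite /code_letter /= enum_valK /=.
by rewrite addnC odd_double_half.
Qed.

Definition word_code (r : seq nat) : Prop := exists w, r = code_letters w.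

(** Replaces the quantifier over reduced words by bounded checks on entries and on neighbouring
    entries, a form that [semi] can process. *)
Lemma word_codeP r : word_code r <->
  (forall i, i < size r -> nth 0 r i < 2 * #|S|) /\
  (forall i, i < (size r).-1 -> nth 0 r i.+1 <> code_inv (nth 0 r i)).
Proof.
have red_sorted s : sorted (fun c d => d != code_inv c) (code_letters s) = reduced s.
  rewrite /reduced sorted_map; apply: eq_sorted => l m /=.
  by rewrite -code_letter_inv (inj_eq code_letter_inj).
split=> [[w ->]|[lt_r red_r]].
  have := freegroupP w; rewrite -red_sorted => /(sortedP 0) red_w.
  split=> [i iw|i iw]; last by apply/eqP/red_w; move: iw; case: (size _).
  have : nth 0 (code_letters w) i \in code_letters w by exact: mem_nth.
  by case/mapP => l _ ->; exact: code_letter_lt.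
have [s sr] : exists s, r = code_letters s.
  elim: r lt_r {red_r} => [|c r IHr] lt_r; first by exists [::].
  have [s ->] := IHr (fun i => lt_r i.+1).
  by have [l /= ->] := code_letter_surj (lt_r 0 isT); exists (l :: s).
have rs : reduced s.
  rewrite -red_sorted -sr; apply/(sortedP 0) => i ir; apply/eqP/red_r.
  by move: ir; case: (size r).
by exists (FreeGroup rs).
Qed.

Lemma recfun_code_inv k a : recfun k a -> recfun k (fun v : seq nat => code_inv (a v)).
Proof.
move=> ra; apply: recfun_graph.
apply: (@eq_semidec _ (fun w : seq nat => exists h,
   (a (behead w) = 2 * h /\ head 0 w = (2 * h).+1) \/
   (a (behead w) = (2 * h).+1 /\ head 0 w = 2 * h))).
  move=> w _; move: (a _) (head 0 w) => c d; rewrite /code_inv; split.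
    case=> h; rewrite mul2n => -[[-> ->]|[-> ->]]; first by rewrite odd_double.
    by rewrite /= odd_double.
  move=> ->; exists c./2; rewrite mul2n; move: (odd_double_half c).
  by move: c./2 => h; case: odd => /= <-; [right|left].
by semi.
Qed.

Lemma semidec_word_code k F : recseq k F -> semidec k (fun v : seq nat => word_code (F v)).
Proof.
move=> rF; apply: eq_semidec => [v _|]; first by rewrite word_codeP; apply: iff_refl.
by repeat first [apply: recfun_code_inv | semi_step].
Qed.

Variable A : set (freegroup S).

(** Cancelling pairs are adjoined to the relators, so that free reduction is also a conversion. The
    number [c] is arbitrary, even if it codes no letter. *)
Definition relator (r : seq nat) : Prop :=
  (exists2 w, A w & r = code_letters w) \/ exists c, r = [:: c; code_inv c].

(** The function [u] is specified only on codes of reduced words, hence the accompanying test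
    [word_code]. *)
Lemma semidec_relator : recursive_set A ->
  forall k F, recseq k F -> semidec k (fun v : seq nat => relator (F v)).
Proof.
case=> u ru uA k F rF; apply: (@eq_semidec _ (fun v : seq nat =>
  (word_code (F v) /\ u (CodeSeq.code (F v)) = 1) \/ exists c, F v = [:: c; code_inv c])).
  move=> v _; rewrite /relator; split=> -[]; [|by right| |by right].
    case=> -[w ->]; rewrite -code_wordE uA; case: asboolP => // Aw _.
    by left; exists w.
  by case=> w Aw ->; left; split; [exists w | rewrite -code_wordE uA asboolT].
apply: semidec_or.
  apply: semidec_and; first exact: semidec_word_code.
  by apply: semidec_eq (recfun_const _ _); exact: recfun_app1.
by repeat first [apply: recfun_code_inv | semi_step].
Qed.

Local Notation conv := (conversion relator).

Lemma conv_cancel c p q : conv (p ++ [:: c, code_inv c & q]) (p ++ q).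
Proof.
apply: rst_sym; apply: rst_step; exists p, q, [:: c; code_inv c].
by split=> //; right; exists c.
Qed.

Lemma conv_push l s : conv (code_letters (push l s)) (code_letter l :: code_letters s).
Proof.
case: s => [|m s] /=; first exact: rst_refl.
case: eqP => [->|_]; last exact: rst_refl.
rewrite /= code_letter_inv; apply: rst_sym; exact: (conv_cancel _ [::]).
Qed.

Lemma conv_mul u v : conv (code_letters (u * v)%g) (code_letters u ++ code_letters v).
Proof.
case: u v => [u ru] [v rv]; rewrite /=; elim: u {ru} => [|l u IHu] /=.
  exact: rst_refl.
apply: rst_trans (conv_push _ _) _.
by have := conversion_cat [:: code_letter l] [::] IHu; rewrite !cats0.
Qed.

Lemma conv_catl s a b : conv a b -> conv (s ++ a) (s ++ b).
Proof. by move=> /(conversion_cat s [::]); rewrite !cats0. Qed.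

Lemma conv_catr s a b : conv a b -> conv (a ++ s) (b ++ s).
Proof. exact: (conversion_cat [::] s). Qed.

Lemma conv_mul1 u v w : conv (code_letters v) [::] ->
  conv (code_letters (u * v * w)%g) (code_letters (u * w)%g).
Proof.
move=> v1; apply: rst_trans (conv_mul _ _) _.
apply: rst_trans (rst_sym _ _ _ _ (conv_mul u w)).
apply: conv_catr; apply: rst_trans (conv_mul _ _) _.
by have := conv_catl (code_letters u) v1; rewrite cats0.
Qed.

(** The elements whose words convert to the empty word form a normal subgroup containing [A]. *)
Lemma conv_normal_closure w : normal_closure A w -> conv (code_letters w) [::].
Proof.
move: w; apply: smallest_sub; last first.
  move=> w Aw; apply: rst_sym; apply: rst_step.
  by exists [::], [::], (code_letters w); rewrite !cats0; split=> //; left; exists w.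
have conv1 u v : conv (code_letters u) [::] -> conv (code_letters (v * u)%g) (code_letters v).
  by move=> /(conv_mul1 v 1%g); rewrite !mulg1.
split; last first.
  move=> x y /(conv_mul1 y^-1%g y); rewrite -mulgA /conjg => e.
  by apply: rst_trans e _; rewrite mulVg; exact: rst_refl.
split; first exact: rst_refl.
  by move=> x y cx cy; exact: rst_trans (conv1 y x cy) cx.
by move=> x cx; have := conv1 _ x^-1%g cx; rewrite mulVg; exact: rst_sym.
Qed.

(** * Soundness and completeness of derivations in the group *)

Variables (Gamma : groupType) (x : S -> Gamma).

(** Numbers coding no letter are sent to 1, which keeps every cancelling pair trivial in the
    group. *)
Definition code_letter_eval (c : nat) : Gamma :=
  if insub c./2 is Some i then letter_eval x (odd c, enum_val (i : 'I_#|S|)) else 1%g.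

Definition code_eval (s : seq nat) : Gamma := (\prod_(c <- s) code_letter_eval c)%g.

Lemma code_eval_cat s t : code_eval (s ++ t) = (code_eval s * code_eval t)%g.
Proof. exact: big_cat. Qed.

Lemma code_letter_evalE l : code_letter_eval (code_letter l) = letter_eval x l.
Proof.
rewrite /code_letter_eval code_letter_half code_letter_odd valK enum_rankK.
by case: l.
Qed.

Lemma code_evalE w : code_eval (code_letters w) = free_eval x w.
Proof.
rewrite /code_eval big_map /free_eval.
by apply: eq_bigr => l _; rewrite code_letter_evalE.
Qed.

Lemma code_letter_eval_inv c : code_letter_eval (code_inv c) = (code_letter_eval c)^-1%g.
Proof.
rewrite /code_letter_eval /code_inv -(odd_double_half c); move: c./2 => h.
case: (odd c); rewrite ?add1n ?add0n /= odd_double /= ?odd_double ?uphalf_double ?doubleK;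
  by case: insubP => [i _ _|_]; rewrite /letter_eval /= ?invgK ?invg1.
Qed.

Lemma conv_eval s t : (forall w, A w -> free_eval x w = 1%g) ->
  conv s t -> code_eval s = code_eval t.
Proof.
move=> A1; elim=> // [a b [p [q [r [rr [-> ->]]]]]|a b c _ -> _ -> //].
rewrite !code_eval_cat; suff -> : code_eval r = 1%g by rewrite mul1g.
case: rr => [[w Aw ->]|[c ->]]; first by rewrite code_evalE A1.
by rewrite /code_eval !big_cons big_nil mulg1 code_letter_eval_inv mulgV.
Qed.

(** Soundness holds because each insertion preserves the value. For completeness, equal values put
    $(lu)^{-1}v$ in the kernel, which is the normal closure of [A]; hence it converts to the empty
    word, and multiplying by $lu$ gives the derivation. *)
Lemma convP (kerA : normal_closure A = [set w | free_eval x w = 1%g]%classic) l u v :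
  conv (code_letter l :: code_letters u) (code_letters v) <->
  (letter_eval x l * free_eval x u)%g = free_eval x v.
Proof.
have evalM : {morph free_eval x : u v / (u * v)%g} by exact: free_evalM.
have elu : code_eval (code_letter l :: code_letters u) = (letter_eval x l * free_eval x u)%g.
  by rewrite /code_eval big_cons code_letter_evalE -code_evalE.
split=> [|e].
  move=> /conv_eval; rewrite elu code_evalE; apply=> w Aw.
  suff : normal_closure A w by rewrite kerA.
  exact: sub_smallest Aw.
pose lw : freegroup S := @FreeGroup S [:: l] isT.
have elw : free_eval x lw = letter_eval x l by rewrite /free_eval big_seq1.
have k1 : normal_closure A ((lw * u)^-1 * v)%g.
  have : (free_eval x ((lw * u)^-1 * v) = 1)%g.
    by rewrite evalM -e -elw -!evalM mulVg free_eval1.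
  by rewrite kerA.
have := conv_mul1 (lw * u)%g 1%g (conv_normal_closure k1).
rewrite !mulg1 mulgA mulgV mul1g => cv.
apply: rst_trans (rst_sym _ _ _ _ cv); exact: rst_sym (conv_mul lw u).
Qed.

End WordCodes.

(** * The coarea argument *)

Section Coarea.

Variables (Gamma : groupType) (X : {fset Gamma}) (R : realFieldType).
Local Open Scope ring_scope.
Implicit Types (h : Gamma -> R) (D Om : {fset Gamma}).

Lemma fset_min (T : choiceType) (D : {fset T}) (h : T -> R) : D != fset0 ->
  exists2 g0, g0 \in D & forall g, g \in D -> h g0 <= h g.
Proof.
case/fset0Pn => g gD.
have [i _ imin] := @arg_minP _ _ D [` gD]%fset xpredT (h \o val) isT.
by exists (val i) => [|g' g'D]; [exact: valP | exact: (imin [` g'D]%fset)].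
Qed.

Lemma mem_ltranslate (x g : Gamma) Om : (g \in ltranslate x Om) = (x^-1 * g \in Om)%g.
Proof.
apply/imfsetP/idP => [[y /= yO ->]|gO]; first by rewrite mulgA mulVg mul1g.
by exists (x^-1 * g)%g => //=; rewrite mulgA mulgV mul1g.
Qed.

Lemma card_ltranslate (x : Gamma) Om : #|` ltranslate x Om| = #|` Om|.
Proof. by apply: card_imfset; exact: mulgI. Qed.

Lemma sum_fset_cond (T : choiceType) (D A : {fset T}) (P : pred T) :
  (forall g, (g \in D) && P g = (g \in A)) ->
  \sum_(g <- D) (P g)%:R = #|` A|%:R :> R.
Proof.
move=> DPA; rewrite card_fset_sum1 natr_sum.
have -> : A = [fset g in D | P g]%fset by apply/fsetP => g; rewrite !inE /= DPA.
rewrite -big_fset_condE [RHS]big_mkcond /=.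
by apply: eq_bigr => g _; case: (P g).
Qed.

(* Namioka's argument without integrals: if the support of h is not a solution,
   subtract from h its least nonzero value on the support and iterate. *)
Lemma coarea_set h D (c : R) : 0 <= c ->
  (forall g, 0 <= h g) -> (forall g, g \notin D -> h g = 0) ->
  0 < \sum_(g <- D) h g ->
  c * \sum_(x <- X) \sum_(g <- D) Num.max 0 (h g - h (x^-1 * g)%g)
    <= \sum_(g <- D) h g ->
  exists Om, [/\ (Om `<=` D)%fset, Om != fset0 &
    c * \sum_(x <- X) #|` (Om `\` ltranslate x Om)%fset|%:R <= #|` Om|%:R].
Proof.
move=> c0; pose supp h := [fset g in D | h g != 0]%fset.
(* Induction on the size of the support; each round removes at least the point where the minimum is
   attained. *)
have [n] := ubnP #|` supp h|; elim: n h => // n IHn h lt_n h0 hD sum_h inv_h.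
set Om := supp h in lt_n; have OmP g : (g \in Om) = (h g != 0).
  by rewrite !inE /=; case: (boolP (g \in D)) => // /hD ->; rewrite eqxx.
have OmD : (Om `<=` D)%fset by apply/fsubsetP => g; rewrite !inE => /andP[].
clearbody Om.
have Om0 : Om != fset0.
  apply: contraTneq sum_h => Om0; rewrite big1 ?ltxx // => g _.
  by apply/eqP/negbNE; rewrite -OmP Om0.
have [le_Om|gt_Om] := lerP (c * \sum_(x <- X) #|` (Om `\` ltranslate x Om)%fset|%:R) #|` Om|%:R.
  by exists Om.
have [g0 g0Om mP] := fset_min h Om0; set m := h g0 in mP.
have m0 : 0 < m by rewrite lt_neqAle eq_sym -OmP g0Om h0.
pose h' g := if g \in Om then h g - m else 0.
have hE g : h g = m * (g \in Om)%:R + h' g.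
  rewrite /h'; case: ifP => [_|/negbT]; first by rewrite mulr1 addrC subrK.
  by rewrite OmP negbK => /eqP ->; rewrite mulr0 addr0.
have h'0 g : 0 <= h' g by rewrite /h'; case: ifP => // /mP; rewrite subr_ge0.
have sumE : \sum_(g <- D) h g = m * #|` Om|%:R + \sum_(g <- D) h' g.
  rewrite -(@sum_fset_cond _ D Om (mem Om)); last first.
    by move=> g /=; rewrite andb_idl // => /(fsubsetP OmD).
  by rewrite mulr_sumr -big_split; apply: eq_bigr => g _; rewrite hE.
(* Since [h] is at least [m] on [Om] and zero off it, removing the layer of height [m] never
   reverses the sign of a difference, so positive parts add up. *)
have maxE x g : Num.max 0 (h g - h (x^-1 * g)%g) =
    m * ((g \in Om) && (x^-1 * g \notin Om)%g)%:R + Num.max 0 (h' g - h' (x^-1 * g)%g).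
  rewrite !hE /h'; case: (boolP (g \in Om)) => gO; case: (boolP (_ \in Om)) => xgO /=;
    rewrite ?mulr0 ?mulr1 ?add0r ?subr0 ?subrr //.
  - by congr Num.max; rewrite opprD addrACA subrr add0r.
  - by rewrite !max_r ?subr_ge0 ?mP // addrC subrK h0.
  - by rewrite !max_l ?oppr_le0 ?subr_ge0 ?mP // addrC subrK h0.
have sum_maxE : \sum_(x <- X) \sum_(g <- D) Num.max 0 (h g - h (x^-1 * g)%g) =
    m * \sum_(x <- X) #|` (Om `\` ltranslate x Om)%fset|%:R +
    \sum_(x <- X) \sum_(g <- D) Num.max 0 (h' g - h' (x^-1 * g)%g).
  rewrite mulr_sumr -big_split; apply: eq_bigr => x _ /=.
  rewrite -(@sum_fset_cond _ D _ (fun g => (g \in Om) && (x^-1 * g \notin Om)%g)).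
    by rewrite mulr_sumr -big_split; apply: eq_bigr => g _; rewrite maxE.
  move=> g; rewrite !inE mem_ltranslate andbC andbAC.
  by case: (boolP (g \in Om)) => [/(fsubsetP OmD) ->|]; rewrite ?andbF ?andbT.
(* [h] satisfies the bound and its bottom layer violates it, so the remainder satisfies it strictly.
   Strictness makes the sum of [h'] positive. *)
have lt_h' : c * \sum_(x <- X) \sum_(g <- D) Num.max 0 (h' g - h' (x^-1 * g)%g)
    < \sum_(g <- D) h' g.
  move: inv_h; rewrite sum_maxE sumE mulrDr mulrCA => le_h.
  rewrite -(ltrD2l (m * #|` Om|%:R)); apply: lt_le_trans le_h.
  by rewrite ltrD2r ltr_pM2l.
apply: (IHn h') => //.
- apply: leq_trans (ltnSE lt_n); apply: fproper_ltn_card.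
  rewrite fproperEneq; apply/andP; split; last first.
    apply/fsubsetP => g; rewrite !inE /= /h' => /andP[_].
    by case: ifP => //; rewrite eqxx.
  apply: contraTneq g0Om => <-; rewrite !inE /= /h'.
  by case: ifP; rewrite ?subrr ?eqxx andbF.
- move=> g gD; rewrite /h'; case: ifP => // /(fsubsetP OmD); by rewrite (negPf gD).
- apply: le_lt_trans lt_h'; rewrite mulr_ge0 // sumr_ge0 // => x _.
  by rewrite sumr_ge0 // => g _; rewrite le_max lexx.
- exact: ltW.
Qed.
End Coarea.

(** * Invariant functions and Folner sets *)

Section FiniteSupport.
Variables (R : realType) (T : choiceType).
Local Open Scope ring_scope.

Lemma esum_finite_support (D : {fset T}) (a : T -> R) :
  (forall g, 0 <= a g) -> (forall g, g \notin D -> a g = 0) ->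
  (\esum_(g in [set: T]) (a g)%:E)%E = (\sum_(g <- D) a g)%:E.
Proof.
move=> a0 aD; transitivity (\esum_(g in [set` D]) (a g)%:E)%E.
  rewrite [RHS]esum_mkcond; apply: eq_esum => g _; case: ifPn => //.
  by rewrite notin_setE /= => /negP /aD ->.
rewrite esum_fset => [||g _]; [|exact: finite_fset|by rewrite lee_fin].
by rewrite -fsbig_seq ?fset_uniq // sumEFin.
Qed.

Lemma sum_le_esum (D : {fset T}) (a : T -> R) : (forall g, 0 <= a g) ->
  ((\sum_(g <- D) a g)%:E <= \esum_(g in [set: T]) (a g)%:E)%E.
Proof.
move=> a0; apply: esum_ge; exists [set` D]%classic.
  by split=> //; exact: finite_fset.
by rewrite -fsbig_seq ?fset_uniq // sumEFin.
Qed.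

End FiniteSupport.

Section Invariance.
Variables (R : realType) (Gamma : groupType) (X : {fset Gamma}).
Local Open Scope ring_scope.
Implicit Types (D Om : {fset Gamma}) (om j : seq Gamma).

Lemma folnerP n Om : (0 < n)%N -> folner X n Om <->
  Om != fset0 /\ forall x, x \in X -> (n * #|` (Om `\` ltranslate x Om)%fset| <= #|` Om|)%N.
Proof.
move=> n0; split=> -[Om0 fOm]; split=> // x /fOm; have cOm : (0 < #|` Om|)%N by rewrite cardfs_gt0.
  rewrite ler_pdivrMr ?ltr0n // mulrC ler_pdivlMr ?ltr0n // mulrC.
  by rewrite -natrM ler_nat.
move=> le_n; rewrite ler_pdivrMr ?ltr0n // mulrC ler_pdivlMr ?ltr0n // mulrC.
by rewrite -natrM ler_nat.
Qed.

(** One level set must serve all generators at once, so the coarea argument is applied to the sum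
    over [X]. The factor [#|X|] in the precision pays for this. *)
Lemma n_invariant_folner (h : Gamma -> R) D n N :
  (0 < n)%N -> (0 < N)%N -> (n * #|` X| <= N)%N ->
  (forall g, g \notin D -> h g = 0) -> n_invariant X N h ->
  exists2 Om, folner X n Om & (Om `<=` D)%fset.
Proof.
move=> n0 N0 le_N hD [h0 _ [g1 hg1] inv_h].
have sum_h : 0 < \sum_(g <- D) h g.
  have g1D : g1 \in D by apply: contraNT hg1 => /hD ->.
  rewrite (big_fsetD1 _ g1D) /= ltr_pwDl ?sumr_ge0 //.
  by rewrite lt_neqAle eq_sym hg1 h0.
have inv_max x : x \in X ->
    (n * #|` X|)%:R * \sum_(g <- D) Num.max 0 (h g - h (x^-1 * g)%g) <= \sum_(g <- D) h g.
  move=> /inv_h; rewrite (esum_finite_support h0 hD).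
  set s := \sum_(g <- D) Num.max _ _ => le_e.
  have s0 : 0 <= s by apply: sumr_ge0 => g _; rewrite le_max lexx.
  apply: (@le_trans _ _ (N%:R * s)); first by rewrite ler_wpM2r // ler_nat.
  rewrite mulrC -ler_pdivlMr ?ltr0n // mulrC -lee_fin EFinM.
  apply: le_trans le_e; apply: le_trans (sum_le_esum D (fun g => normr_ge0 _)).
  rewrite lee_fin; apply: ler_sum => g _.
  by rewrite ge_max normr_ge0 ler_norm.
have [|||||Om [OmD Om0 cOm]] := @coarea_set _ X _ h D n%:R => //.
  (* The next step cancels a factor [#|X|], so empty [X] is set apart. *)
  have [X0|X0] := posnP #|` X|.
    by rewrite (cardfs0_eq X0) big_nil mulr0 ltW.
  rewrite -(@ler_pM2l _ #|` X|%:R) ?ltr0n // mulrA -natrM mulnC mulr_sumr.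
  apply: (@le_trans _ _ (\sum_(x <- X) \sum_(g <- D) h g)).
    by rewrite big_seq [leRHS]big_seq; apply: ler_sum => x /inv_max.
  by rewrite big_const_seq count_predT iter_addr_0 mulr_natl.
exists Om => //; apply/folnerP => //; split=> // x xX.
rewrite -(ler_nat R) natrM; apply: le_trans cOm; rewrite ler_wpM2l //.
by rewrite (big_fsetD1 _ xX) /= lerDl sumr_ge0.
Qed.

Lemma sum_count_mem (T : choiceType) (D : {fset T}) (s : seq T) :
  {subset s <= D} -> \sum_(g <- D) (count_mem g s)%:R = (size s)%:R :> R.
Proof.
elim: s => [_|y s IHs sD]; first by rewrite big1.
under eq_bigr do rewrite /= natrD.
rewrite big_split /= IHs => [|z zs]; last by rewrite sD // inE zs orbT.
rewrite -[(size s).+1]add1n natrD; congr (_ + _).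
have yD : y \in D by rewrite sD ?mem_head.
rewrite (big_fsetD1 _ yD) /= eqxx big_seq big1 ?addr0 // => z.
by rewrite !inE eq_sym => /andP[/negPf ->].
Qed.

Lemma count_mem_mulg (x g : Gamma) om :
  count_mem g [seq (x * y)%g | y <- om] = count_mem (x^-1 * g)%g om.
Proof.
rewrite count_map; apply: eq_count => y /=.
by apply/eqP/eqP => [<-|->]; rewrite ?mulgA ?mulVg ?mulgV mul1g.
Qed.

Lemma count_n_invariant om j n : (0 < n)%N -> (0 < size om)%N ->
  (2 * n * size j <= size om)%N ->
  (forall x, x \in X -> forall g,
     (count_mem g [seq (x * y)%g | y <- om] <= count_mem g (om ++ j))%N) ->
  n_invariant X n (fun g => (count_mem g om)%:R : R).
Proof.
move=> n0 om0 le_j count_x; set h := fun g => _.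
have h0 g : 0 <= h g by [].
have hsupp (D : {fset Gamma}) : {subset om <= D} -> forall g, g \notin D -> h g = 0.
  move=> omD g; rewrite /h; have [/omD ->//|/count_memPn ->] := boolP (g \in om).
  by [].
have esum_h : (\esum_(g in [set: Gamma]) (h g)%:E)%E = (size om)%:R%:E.
  rewrite (@esum_finite_support _ _ [fset y in om]%fset) //.
    by rewrite sum_count_mem // => y; rewrite !inE.
  by apply: hsupp => y; rewrite !inE.
split=> //.
- rewrite summableE; under eq_esum do rewrite gee0_abs ?lee_fin //.
  by rewrite esum_h.
- exists (nth 1%g om 0); rewrite /h pnatr_eq0 -lt0n -has_count has_pred1.
  by rewrite mem_nth.
move=> x xX; set E := [fset y in om ++ j ++ [seq (x * y)%g | y <- om]]%fset.
have omE : {subset om <= E} by move=> y yom; rewrite !inE /= ?mem_cat yom.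
have jE : {subset j <= E} by move=> y yj; rewrite !inE /= ?mem_cat yj orbT.
have xomE : {subset [seq (x * y)%g | y <- om] <= E}.
  by move=> y yom; rewrite !inE /= ?mem_cat yom !orbT.
have hxE g : h (x^-1 * g)%g = (count_mem g [seq (x * y)%g | y <- om])%:R.
  by rewrite count_mem_mulg.
rewrite esum_h (@esum_finite_support _ _ E) //; last first.
  move=> g gE; rewrite hxE (hsupp E) // sub0r normrN normr_nat.
  by rewrite (count_memPn _) //; apply: contraNN gE => /xomE.
rewrite -EFinM lee_fin mulrC ler_pdivlMr ?ltr0n // mulrC.
apply: (@le_trans _ _ (n%:R * \sum_(g <- E) (h g - h (x^-1 * g)%g + (count_mem g j)%:R *+ 2))).
  rewrite ler_wpM2l //; apply: ler_sum => g _.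
  (* From c <= b + a and 0 <= a follows |b - c| <= (b - c) + 2 a; the terms b - c sum to 0. *)
  have : h (x^-1 * g)%g <= h g + (count_mem g j)%:R.
    by rewrite hxE -natrD ler_nat -count_cat; exact: count_x.
  have : 0 <= (count_mem g j)%:R :> R by [].
  move: (_%:R : R) (h g) (h _) => a b c a0 le_c; rewrite ler_norml; apply/andP; split.
    by rewrite mulr2n; lra.
  by rewrite lerDl mulrn_wge0.
rewrite big_split sumrB /= (sum_count_mem omE); under [X in _ - X]eq_bigr do rewrite hxE.
rewrite (sum_count_mem xomE) size_map subrr add0r sumrMnl (sum_count_mem jE).
by rewrite -mulrnA -natrM ler_nat (mulnC (size j)) mulnA (mulnC n).
Qed.

Lemma amenable_lists C : amenable X ->
  exists om, exists j, [/\ uniq (om ++ j), (0 < size om)%N, (C * size j <= size om)%N &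
    forall x, x \in X -> forall y, y \in om -> (x * y)%g \in om ++ j].
Proof.
(* The outer boundary is a union over [X], whence the factor [#|X|]; the successor keeps the
   precision positive. *)
move=> /(_ (C * #|` X|).+1 isT) [Om /folnerP [//|Om0 fOm]].
pose j := undup (flatten [seq enum_fset (ltranslate x Om `\` Om)%fset | x <- enum_fset X]).
have jP y : y \in j -> y \notin Om.
  by rewrite mem_undup => /flatten_mapP[x _]; rewrite inE => /andP[].
exists (enum_fset Om), j; split.
- rewrite cat_uniq fset_uniq undup_uniq andbT /=.
  by apply/hasPn => y /jP.
- by rewrite cardfs_gt0.
- have [X0|X0] := posnP #|` X|.
    by rewrite /j (cardfs0_eq X0) muln0.
  rewrite -(leq_pmul2l X0) mulnCA mulnA.
  apply: (@leq_trans (C * #|` X| * \sum_(x <- X) #|` (Om `\` ltranslate x Om)%fset|)).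
    rewrite leq_mul2l; apply/orP; right; apply: leq_trans (size_undup _) _.
    rewrite size_flatten sumnE /shape !big_map leq_sum // => x _.
    (* A set and its translate have equal size, so outer and inner boundary have equal size too. *)
    by rewrite !cardfsD card_ltranslate fsetIC.
  rewrite big_distrr /=.
  apply: (@leq_trans (\sum_(x <- X) #|` Om|)).
    rewrite !big_seq leq_sum // => x /fOm; apply: leq_trans.
    by rewrite leq_mul2r leqnSn orbT.
  by rewrite big_const_seq count_predT iter_addn_0 mulnC.
- move=> x xX y yOm; rewrite mem_cat; have [//|xyOm] := boolP ((x * y)%g \in Om).
  rewrite /= mem_undup; apply/flatten_mapP; exists x => //.
  by rewrite inE xyOm mem_ltranslate mulgA mulVg mul1g.
Qed.

End Invariance.

(** * The search *)

Section Search.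

Variables (S : finType) (A : set (freegroup S)).

(* s lists the codes of k words; T represents the injection of the indices
   below k into those of s ++ j along which the letter a translates s. *)
Definition almost_invariant (C n : nat) (s : seq nat) : Prop :=
  exists j : seq nat, 0 < size s /\ (uniq s /\
  ((forall i, i < size s -> word_code S (CodeSeq.decode (nth 0 s i))) /\
  (C * n * size j <= size s /\
  forall a, a < #|S| -> exists T : seq nat, size T = size s /\ (uniq T /\
    forall i, i < size s -> nth 0 T i < size s + size j /\
      conversion (relator A) (2 * a :: CodeSeq.decode (nth 0 s i))
        (CodeSeq.decode (nth 0 (s ++ j) (nth 0 T i))))))).

Lemma semidec_almost_invariant C k N F : recursive_set A ->
  recfun k N -> recseq k F ->
  semidec k (fun v => almost_invariant C (N v) (F v)).
Proof.
move=> rA rN rF; rewrite /almost_invariant.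
by repeat first [apply: semidec_word_code
  | apply: (semidec_conversion (semidec_relator rA)) | semi_step].
Qed.

Lemma almost_invariant_code C : recursive_set A ->
  (forall n, exists s, almost_invariant C n s) ->
  exists2 u, recursive1 u & forall n, almost_invariant C n (CodeSeq.decode (u n)).
Proof.
move=> rA ex_s.
apply: (@semidec_choose (fun c n => almost_invariant C n (CodeSeq.decode c))).
  by repeat first [apply: semidec_almost_invariant | semi_step].
by move=> n; have [s ?] := ex_s n; exists (CodeSeq.code s); rewrite CodeSeq.codeK.
Qed.

(** Produces the encoding of a function with constant value coded by [K] on the words of [s]. The
    encoding is searched for together with [s] and checked entry by entry. *)
Lemma almost_invariant_weighted_code C K : recursive_set A ->
  (forall n, exists s, almost_invariant C n s) ->
  exists2 u, recursive1 u & forall n, exists2 s, almost_invariant C n s &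
    u n = CodeSeq.code [seq CodeSeq.code [:: c; K] | c <- s].
Proof.
move=> rA ex_s; pose P c n := exists s, almost_invariant C n s /\
  (size (CodeSeq.decode c) = size s /\ forall i, i < size s ->
     nth 0 (CodeSeq.decode c) i = CodeSeq.code [:: nth 0 s i; K]).
have [||u ru uP] := @semidec_choose P.
- by rewrite /P; repeat first [apply: semidec_almost_invariant | semi_step].
- move=> n; have [s sP] := ex_s n.
  exists (CodeSeq.code [seq CodeSeq.code [:: c; K] | c <- s]); exists s.
  rewrite CodeSeq.codeK size_map; split=> //; split=> // i si.
  by rewrite (nth_map 0).
exists u => // n; have [s [sP [su nu]]] := uP n; exists s => //.
rewrite -[LHS]CodeSeq.decodeK; congr CodeSeq.code.
apply: (@eq_from_nth _ 0); first by rewrite size_map.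
by rewrite su => i si; rewrite nu // (nth_map 0).
Qed.

Variables (Gamma : groupType) (X : {fset Gamma}) (b : S -> X).
Hypotheses (bij_b : bijective b) (gen_X : generated [set` X]%classic = [set: Gamma]%classic).
Hypothesis kerA : normal_closure A = [set w | marking b w = 1%g]%classic.

Lemma marking_surj g : exists w, marking b w = g.
Proof.
suff: (generated [set` X] `<=` range (marking b))%classic.
  by rewrite gen_X => /(_ g I)[w _ <-]; exists w.
have [a ba ab] := bij_b.
apply: smallest_sub => [|x /= xX].
  split; first by exists 1%g => //; exact: free_eval1.
  - move=> _ _ [u _ <-] [v _ <-]; exists (u * v)%g => //; exact: free_evalM.
  - move=> _ [u _ <-]; exists u^-1%g => //.
    exact: (gmulfV (marking b)).
exists (@FreeGroup S [:: (false, a [` xX]%fset)] isT) => //.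
by rewrite /marking /free_eval big_seq1 /letter_eval /= ab.
Qed.

(** Reading a list at distinct positions yields a sub-multiset; this turns the injections [T] into
    inequalities between multiplicities. *)
Lemma count_map_nth (T : Type) (x0 : T) (p : pred T) (t : seq T) (I : seq nat) :
  uniq I -> {subset I <= iota 0 (size t)} ->
  count p [seq nth x0 t i | i <- I] <= count p t.
Proof.
move=> uI It; rewrite -[t in X in _ <= X](mkseq_nth x0) !count_map -!size_filter.
apply: uniq_leq_size; first exact: filter_uniq.
by move=> i; rewrite !mem_filter => /andP[-> /It].
Qed.

Lemma almost_invariant_sound C n s : almost_invariant C n s ->
  exists ws, exists j : seq Gamma, [/\ s = map (@code_word S) ws, uniq ws, 0 < size ws,
    C * n * size j <= size ws &
    forall x, x \in X -> forall g,
      count_mem g [seq (x * y)%g | y <- map (marking b) ws] <=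
      count_mem g (map (marking b) ws ++ j)].
Proof.
case=> j [s0 [us [ws_s [le_j T_s]]]]; pose ev := code_eval (fun a => val (b a)).
have [ws sE] : exists ws, s = map (@code_word S) ws.
  elim: s ws_s {s0 us le_j T_s} => [|c s IHs] wcs; first by exists [::].
  have [w cw] := wcs 0 isT; have [ws ->] := IHs (fun i => wcs i.+1).
  by exists (w :: ws); rewrite /= -[c]CodeSeq.decodeK cw.
have A1 w : A w -> free_eval (fun a => val (b a)) w = 1%g.
  move=> Aw; suff : normal_closure A w by rewrite kerA.
  exact: sub_smallest Aw.
(* Entries of [j] need not code reduced words, so the decoded lists are evaluated directly. *)
exists ws, (map (ev \o CodeSeq.decode) j); split=> //.
- by move: us; rewrite sE; exact: map_uniq.
- by rewrite -(size_map (@code_word S)) -sE.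
- by rewrite -(size_map (@code_word S)) -sE size_map.
move=> x xX g; have [a ba ab] := bij_b; set y := a [` xX]%fset.
have [T [sT [uT TP]]] := T_s (enum_rank y) (ltn_ord _).
have omE : map (marking b) ws = map (ev \o CodeSeq.decode) s.
  rewrite sE -map_comp; apply: eq_map => w /=.
  by rewrite code_wordE CodeSeq.codeK /ev code_evalE.
rewrite omE -map_cat.
suff -> : [seq (x * z)%g | z <- map (ev \o CodeSeq.decode) s] =
    [seq nth 1%g (map (ev \o CodeSeq.decode) (s ++ j)) i | i <- T].
  apply: count_map_nth => // i /(nthP 0)[k]; rewrite sT => /TP[lt_k _] <-.
  by rewrite mem_iota size_map size_cat.
apply: (@eq_from_nth _ 1%g); rewrite !size_map // => i si.
have [lt_i /(conv_eval A1) e] := TP i si.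
rewrite (nth_map 1%g) ?size_map // (nth_map 0) ?sT // !(nth_map 0) ?size_cat //=.
rewrite /ev -e /code_eval big_cons; congr (_ * _)%g.
rewrite mul2n -[(enum_rank y).*2]addn0 -[_ + 0]/(code_letter (false, y)).
by rewrite code_letter_evalE /letter_eval /= /y ab.
Qed.

Lemma amenable_almost_invariant C n : amenable X -> exists s, almost_invariant C n s.
Proof.
move=> /(amenable_lists (C * n))[om [j [uoj om0 le_j mulP]]].
(* A section of the marking. Choice is enough, since the search needs only the existence of a
   certificate. *)
have [phi phiP] := choice marking_surj.
have cphi_inj : injective (@code_word S \o phi).
  by move=> g h /code_word_inj e; rewrite -(phiP g) e phiP.
exists (map (@code_word S \o phi) om), (map (@code_word S \o phi) j).
rewrite -map_cat !size_map; split=> //; split.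
  by rewrite map_inj_uniq //; move: uoj; rewrite cat_uniq => /and3P[].
split.
  move=> i iom; rewrite (nth_map 1%g) //= code_wordE CodeSeq.codeK.
  by eexists.
split=> // a aS; pose y := enum_val (Ordinal aS); set x := val (b y).
have xX : x \in X by exact: valP.
(* [T] records the position of each translate in [om ++ j]; it is injective because left
   multiplication is. *)
exists [seq index (x * g)%g (om ++ j) | g <- om]; rewrite size_map; split=> //; split.
  rewrite map_inj_in_uniq; first by move: uoj; rewrite cat_uniq => /and3P[].
  move=> g h gom hom e; apply: (@mulgI _ x).
  by rewrite -(nth_index 1%g (mulP _ xX _ gom)) e nth_index // mulP.
move=> i iom; rewrite (nth_map 1%g) // -size_cat index_mem.
have xg := mulP _ xX _ (mem_nth 1%g iom); split=> //.
rewrite !(nth_map 1%g) ?index_mem //= nth_index // !code_wordE !CodeSeq.codeK.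
have -> : 2 * a = code_letter (false, y).
  by rewrite /code_letter /= enum_valK addn0 mul2n.
apply/(convP kerA); rewrite /letter_eval /=.
by have := phiP; rewrite /marking => e; rewrite !e.
Qed.

End Search.

(** * The equivalences *)

Section Equivalences.

Variables (R : realType) (Gamma : groupType) (X : {fset Gamma}).

(** Lets the number output by the search serve as the recursive bound on the Folner function. *)
Lemma leq_size_code s : size s <= CodeSeq.code s.
Proof.
elim: s => //= c s IHs; rewrite -[_.+1]mul1n leq_mul ?expn_gt0 // ltnS.
by rewrite (leq_trans IHs) // -addnn leq_addr.
Qed.

Lemma subrecursive_folner_amenable : subrecursive_folner X -> amenable X.
Proof.
case=> u _ uP n /uP[k]; rewrite /folner_function.
by case: pselect => // e _ _; case: e => m /asboolP[Om fOm _]; exists Om.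
Qed.

Lemma folner_function_le n Om : folner X n Om ->
  exists2 k, folner_function X n = Some k & k <= #|` Om|.
Proof.
move=> fOm; rewrite /folner_function; case: pselect => [e|[]]; last first.
  by exists #|` Om|; apply/asboolP; exists Om.
exists (ex_minn e) => //; case: ex_minnP => m _; apply.
by apply/asboolP; exists Om.
Qed.

Variables (S : finType) (b : S -> X).
Implicit Types ws : seq (freegroup S).

Lemma pushforward_finite_support (f : freegroup S -> rat) (F : seq (freegroup S)) g :
  uniq F -> (forall w, w \notin F -> f w = 0%R) ->
  pushforward b f g = (\sum_(w <- F | marking b w == g) f w)%R.
Proof.
move=> uF f0; rewrite /pushforward (@bigfs _ _ _ _ F (fun w => marking b w == g)) //.
  by apply: eq_fsbigl; apply/seteqP; split=> w /= /eqP.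
by move=> w _ /f0.
Qed.

Lemma computable_reiter_amenable : computable_reiter b R -> amenable X.
Proof.
(* Passing to a level set loses a factor [#|X|]; the successor keeps the precision positive when [X]
   is empty. *)
case=> u _ uP n n0; have [f [_ _ inv_f]] := uP (n * #|` X|).+1 isT.
pose D := [fset marking b w | w in finsupp f]%fset.
have [||||Om fOm _] := @n_invariant_folner R _ X _ D n _ _ _ _ _ inv_f => //.
- move=> g gD; rewrite (@pushforward_finite_support _ (finsupp f)) ?fset_uniq //.
    rewrite big1_seq ?rmorph0 // => w /andP[/eqP wg wf].
    by case/negP: gD; rewrite -wg; apply: in_imfset.
  by move=> w wf; exact: fsfun_dflt.
by exists Om.
Qed.

(** Links indicators of word lists with the multiplicity functions of [count_n_invariant]. *)
Lemma pushforward_indicator ws (f : {fsfun freegroup S -> rat with 0%R}) g :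
  uniq ws -> (forall w, f w = (w \in ws)%:R%R) ->
  pushforward b f g = (count_mem g (map (marking b) ws))%:R%R.
Proof.
move=> uws fE; rewrite (@pushforward_finite_support _ ws) //; last first.
  by move=> w /negPf; rewrite fE => ->.
rewrite count_map -sum1_count natr_sum big_seq_cond [RHS]big_seq_cond.
by apply: eq_bigr => w /andP[wws _]; rewrite fE wws.
Qed.

Lemma sound_folner C n ws (j : seq Gamma) : 0 < n -> 0 < size ws ->
  C * n * size j <= size ws -> 2 * #|` X|.+1 <= C ->
  (forall x, x \in X -> forall g,
     count_mem g [seq (x * y)%g | y <- map (marking b) ws] <=
     count_mem g (map (marking b) ws ++ j)) ->
  exists2 Om, folner X n Om & (Om `<=` [fset marking b w | w in ws])%fset.
Proof.
move=> n0 ws0 le_j leC count_x.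
have N0 : 0 < n * #|` X|.+1 by rewrite muln_gt0 n0.
have inv := @count_n_invariant R _ X (map (marking b) ws) j (n * #|` X|.+1) N0 _ _ count_x.
apply: n_invariant_folner (inv _ _) => //; rewrite ?size_map //.
- by rewrite leq_mul2l leqnSn orbT.
- move=> g gD; rewrite (count_memPn _) //; apply: contraNN gD => /mapP[w wws ->].
  exact: in_imfset.
- apply: leq_trans le_j; rewrite leq_mul2r mulnCA mulnC.
  by rewrite leq_mul2r leC !orbT.
Qed.

End Equivalences.

Local Open Scope classical_set_scope.

Theorem theorem3p1 (R : realType) (Gamma : groupType) (X : {fset Gamma})
    (S : finType) (b : S -> X) (bij_b : bijective b)
    (gen_X : generated [set` X] = [set: Gamma])
    (rec_pres : recursively_presentable b) :
  [<-> amenable X;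
       subrecursive_folner X;
       computable_folner_superset b;
       computable_reiter b R].
Proof.
(* In [C], the 2 comes from the estimate of [count_n_invariant] and [#|X|.+1] from the passage to a
   level set. *)
have [A rA kerA] := rec_pres; pose C := (2 * #|` X|.+1)%N.
have ex_s : amenable X -> forall n, exists s, almost_invariant A C n s.
  by move=> amX n; exact: (amenable_almost_invariant bij_b gen_X kerA).
have folner_amenable : computable_folner_superset b -> amenable X.
  by case=> u _ uP n /uP[F _ [Om fOm _]]; exists Om.
tfae.
- move=> /ex_s /(almost_invariant_code rA)[u ru uP]; exists u => // n n0.
  have [ws [j [uE _ ws0 le_j count_x]]] := almost_invariant_sound bij_b kerA (uP n).
  have [Om fOm Omws] := sound_folner R n0 ws0 le_j (leqnn _) count_x.
  have [k Fk le_k] := folner_function_le fOm; exists k => //.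
  apply: (leq_trans le_k); rewrite -[u n]CodeSeq.decodeK.
  apply: leq_trans (leq_size_code _); rewrite uE size_map -(size_map (marking b)).
  apply: uniq_leq_size => [|g /(fsubsetP Omws)/imfsetP[w /= wws ->]]; first exact: fset_uniq.
  exact: map_f.
(* A bounded Folner function takes finite values, which gives amenability; the superset is then the
   output of the search. *)
- move=> /subrecursive_folner_amenable /ex_s /(almost_invariant_code rA)[u ru uP].
  exists u => // n n0.
  have [ws [j [uE _ ws0 le_j count_x]]] := almost_invariant_sound bij_b kerA (uP n).
  have [Om fOm Omws] := sound_folner R n0 ws0 le_j (leqnn _) count_x.
  exists [fset w in ws]%fset.
    by exists ws => [w|]; [rewrite inE | rewrite -uE CodeSeq.decodeK].
  exists Om => //; apply: (fsubset_trans Omws); apply/fsubsetP => g.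
  by case/imfsetP => w /= wws ->; apply: in_imfset; rewrite inE.
(* Every word of the list gets weight 1, so the output codes an indicator function. *)
- move=> /folner_amenable /ex_s /(almost_invariant_weighted_code (code_rat 1) rA).
  case=> u ru uP; exists u => // n n0; have [s sP uE] := uP n.
  have [ws [j [sE uws ws0 le_j count_x]]] := almost_invariant_sound bij_b kerA sP.
  pose f : {fsfun freegroup S -> rat with 0%R} :=
    [fsfun w in [fset w in ws]%fset => 1%R].
  have fE w : f w = (w \in ws)%:R%R.
    by rewrite fsfunE inE; case: (w \in ws).
  exists f; split.
  + exists ws; first by move=> w; rewrite mem_finsupp fE; case: (w \in ws).
    rewrite uE sE -map_comp; congr CodeSeq.code.
    by apply/eq_in_map => w wws /=; rewrite fE wws.
  + by move=> w; rewrite fE.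
  have -> : (fun g => ratr (pushforward b f g) : R) =
      fun g => (count_mem g (map (marking b) ws))%:R%R.
    by apply/funext => g; rewrite (pushforward_indicator _ _ uws fE) ratr_nat.
  apply: (@count_n_invariant _ _ _ _ j) => //; rewrite size_map //.
  apply: leq_trans le_j; rewrite leq_mul2r -mulnA leq_mul2l mulnC.
  by rewrite leq_pmulr ?orbT.
- exact: computable_reiter_amenable.
Qed.
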